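(* Let $\Gamma_3\ge\Gamma_2\ge\Gamma_1\ge0$. The capacity region $\mathcal{C}(\Gamma_1,\Gamma_2,\Gamma_3)$ of the Gaussian 3-way channel 3WC$(\Gamma_1,\Gamma_2,\Gamma_3)$ satisfies $\mathcal{C}(\Gamma_1,\Gamma_2,\Gamma_3)\subseteq\overline{\mathcal{C}}(\Gamma_1,\Gamma_2,\Gamma_3)$, where $\overline{\mathcal{C}}(\Gamma_1,\Gamma_2,\Gamma_3)$ is the set of all $(R_{21},R_{31},R_{12},R_{32},R_{13},R_{23})\in\mathbb{R}_+^6$ satisfying \begin{align*} R_{12}+R_{13}+R_{32}&\leq \hat{C}(\Gamma_3)+2,\\ R_{12}+R_{13}+R_{23}&\leq \hat{C}(\Gamma_3)+2,\\ R_{21}+R_{23}+R_{31}&\leq \hat{C}(\Gamma_3)+2,\\ R_{21}+R_{23}+R_{13}&\leq \hat{C}(\Gamma_3\Gamma_2/\Gamma_1)+2,\\ R_{31}+R_{32}+R_{21}&\leq \hat{C}(\Gamma_3)+2,\\ R_{31}+R_{32}+R_{12}&\leq \hat{C}(\Gamma_3\Gamma_2/\Gamma_1)+2,\\ R_{13}+R_{23}&\leq \hat{C}(\Gamma_2)+1,\\ R_{31}+R_{32}&\leq \hat{C}(\Gamma_2)+3/2 \end{align*} (if $\Gamma_1=0$, the two constraints involving $\Gamma_3\Gamma_2/\Gamma_1$ are void).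
   Context: Notation: $C(x)=\frac12\log_2(1+x)$ and $\hat{C}(x)=\max\{0,C(x-1)\}=\max\{0,\frac12\log_2 x\}$. Gaussian 3-way channel (3WC). Three full-duplex users $1,2,3$; at time $t$, for distinct $i,j,k\in\{1,2,3\}$, user $i$ receives $y_i(t)=h_jx_k(t)+h_kx_j(t)+z_i(t)$, where $x_i(t)\in\mathbb{R}$ is the transmit signal of user $i$, $h_i\in\mathbb{R}$ is the constant, reciprocal channel coefficient between users $j$ and $k$ (known to all users), and the noises $z_i(t)\sim\mathcal{N}(0,1)$ are independent across users and i.i.d. over time. Every user has (average) power constraint $P$: $\frac1n\sum_{t=1}^n\mathbb{E}[x_i(t)^2]\le P$. SNRs: $\Gamma_i=h_i^2P$. The users are labeled so that $h_3^2\ge h_2^2\ge h_1^2$. User $i$ has independent messages $w_{ji}$ and $w_{ki}$, uniformly distributed over sets $\mathcal{W}_{ji},\mathcal{W}_{ki}$, of rates $R_{ji}$ and $R_{ki}$, intended for users $j$ and $k$ respectively (so $w_{ab}$ goes from user $b$ to user $a$). All six messages are independent. Encoding may be adaptive: $x_i(t)=\mathcal{E}_{it}(w_{ji},w_{ki},y_i(1),\dots,y_i(t-1))$. After $n$ channel uses user $i$ decodes $(\hat w_{ij},\hat w_{ik})=\mathcal{D}_i(w_{ji},w_{ki},y_i(1),\dots,y_i(n))$. A rate tuple is achievable if the probability that some message is decoded incorrectly can be made to tend to $0$ as $n\to\infty$. The capacity region $\mathcal{C}(\Gamma_1,\Gamma_2,\Gamma_3)\subset\mathbb{R}_+^6$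 is the set of all achievable tuples $(R_{21},R_{31},R_{12},R_{32},R_{13},R_{23})$. *)

(* Defs.v *)
From HB Require Import structures.
From mathcomp Require Import all_boot all_order all_algebra.
From mathcomp Require Import all_classical all_reals all_analysis.
Set Implicit Arguments.
Unset Strict Implicit.
Unset Printing Implicit Defensive.
Import Order.TTheory GRing.Theory Num.Theory.
Import numFieldNormedType.Exports.
Local Open Scope classical_set_scope.
Local Open Scope ring_scope.

Section iid.
Context d (T : measurableType d) (R : realType) (P : probability T R).

Definition cons_pair n (x : T * n.-tuple T) : n.+1.-tuple T :=
  [the n.+1.-tuple T of x.1 :: x.2].

Lemma measurable_cons_pair n : measurable_fun setT (@cons_pair n).
Proof. exact: measurable_cons measurable_fst measurable_snd. Qed.

HB.instance Definition _ n :=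
  isMeasurableFun.Build _ _ _ _ (@cons_pair n) (@measurable_cons_pair n).

(* The law of n i.i.d. samples of P. *)
Fixpoint iid (n : nat) : probability (n.-tuple T) R :=
  match n with
  | 0 => \d_[tuple]
  | n.+1 => distribution (P \x iid n)%E (@cons_pair n)
  end.

End iid.

(* The users 1, 2, 3 are the elements 1, 2, 3 of 'Z_3 (so that user 3 is 0);
   the two users other than i are then i + 1 and i + 2. *)
Notation user := 'Z_3.

Section three_way_channel.
Context {R : realType}.
Implicit Types (h : user -> R) (P : R).

Definition log2 (x : R) : R := ln x / ln 2.
Definition C (x : R) : R := log2 (1 + x) / 2.
(* As ln 0 = 0 by convention, Chat 0 = 0 = max{0, -oo}. *)
Definition Chat (x : R) : R := Num.max 0 (C (x - 1)).

(* msgs j i is the size of the set W_ji of the messages from user i to user j.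
   The messages sent by user i form a family indexed by all the users; its own
   component is a dummy, ranging over a set with one element. *)
Definition sent (msgs : user -> user -> nat) (i : user) : finType :=
  {dffun forall j : user, 'I_(msgs j i)}.

(* In enc i t and in the argument of dec i, the tuples consist of the first t
   and n channel outputs at user i. Time starts at 0, and enc i t matters only
   for t < n. *)
Record channel_code (n : nat) := Code {
  msgs : user -> user -> nat;
  msgs_gt0 : forall j i, (0 < msgs j i)%N;
  msgs_self : forall i, msgs i i = 1%N;
  enc : forall (i : user) (t : nat),
    sent msgs i -> t.-tuple (measurableTypeR R) -> R;
  measurable_enc : forall i t w, measurable_fun setT (@enc i t w);
  dec : forall i : user,
    sent msgs i -> n.-tuple (measurableTypeR R) -> forall j : user, 'I_(msgs i j);
  measurable_dec : forall i w j m, measurable [set y | @dec i w y j = m] }.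

(* w i j is the message w_ji. *)
Definition messages n (c : channel_code n) : finType :=
  {dffun forall i : user, sent (msgs c) i}.

(* The channel outputs at user i before time t, given the messages w and the
   noise z. The coefficient h k is that of the link between the two users other
   than k. *)
Fixpoint outputs h n (c : channel_code n) (w : messages c) (z : nat -> user -> R)
    (t : nat) (i : user) : t.-tuple (measurableTypeR R) :=
  match t with
  | 0 => [tuple]
  | t.+1 =>
    let x k := enc (w k) (outputs h w z t k) in
    [tuple of rcons (outputs h w z t i)
      (h (i + 1) * x (i + 2) + h (i + 2) * x (i + 1) + z t i)]
  end.

Definition input h n (c : channel_code n) (w : messages c) z (t : nat) (i : user) : R :=
  enc (w i) (outputs h w z t i).

(* The noise samples of the three users over n channel uses. *)
Definition noise_law (n : nat) :
    probability (n.-tuple (3.-tuple (measurableTypeR R))) R :=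
  iid (iid (normal_prob 0 1) 3) n.

Definition noise n (s : n.-tuple (3.-tuple (measurableTypeR R)))
    (t : nat) (i : user) : R :=
  tnth (nth [tuple of nseq 3 0] s t) i.

(* The average over independent, uniformly distributed messages. *)
Definition msg_mean n (c : channel_code n) (f : messages c -> \bar R) : \bar R :=
  ((#|messages c|%:R^-1)%:E * \sum_(w : messages c) f w)%E.

Definition power h n (c : channel_code n) (i : user) : \bar R :=
  ((n%:R^-1)%:E * \sum_(t < n)
     msg_mean (fun w : messages c =>
       'E_(noise_law n)[fun s => (input h w (noise s) t i ^+ 2)%R]))%E.

Definition error_prob h n (c : channel_code n) : \bar R :=
  msg_mean (fun w : messages c => noise_law n
    [set s | exists i j, dec (w i) (outputs h w (noise s) n i) j != w j i]).

(* A rate tuple is a function r with r j i = R_ji for j != i; its diagonal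
   carries no meaning. *)
Definition achievable P h (r : user -> user -> R) : Prop :=
  exists c : forall n, channel_code n,
    [/\ forall n i, (power h (c n) i <= P%:E)%E,
        forall j i, j != i -> log2 (msgs (c n) j i)%:R / n%:R @[n --> \oo] --> r j i
      & error_prob h (c n) @[n --> \oo] --> 0%E].

Definition capacity_region P h : set (user -> user -> R) :=
  [set r | (forall j i, j != i -> 0 <= r j i) /\ achievable P h r].

Definition outer_region (G : user -> R) : set (user -> user -> R) :=
  [set r | (forall j i, j != i -> 0 <= r j i) /\
   [/\ r 1 2 + r 1 3 + r 3 2 <= Chat (G 3) + 2,
       r 1 2 + r 1 3 + r 2 3 <= Chat (G 3) + 2,
       r 2 1 + r 2 3 + r 3 1 <= Chat (G 3) + 2,
       G 1 != 0 -> r 2 1 + r 2 3 + r 1 3 <= Chat (G 3 * G 2 / G 1) + 2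
     & r 3 1 + r 3 2 + r 2 1 <= Chat (G 3) + 2] /\
   [/\ G 1 != 0 -> r 3 1 + r 3 2 + r 1 2 <= Chat (G 3 * G 2 / G 1) + 2,
       r 1 3 + r 2 3 <= Chat (G 2) + 1
     & r 3 1 + r 3 2 <= Chat (G 2) + 3 / 2]].

End three_way_channel.

(* Main.v *)
Require Import Defs.
From HB Require Import structures.
From mathcomp Require Import all_boot all_order all_algebra.
From mathcomp Require Import all_classical all_reals all_analysis.
From mathcomp Require Import measurable_realfun.
From mathcomp Require Import ring lra.
Import Order.TTheory GRing.Theory Num.Theory.
Import numFieldNormedType.Exports.
Local Open Scope classical_set_scope.
Local Open Scope ring_scope.
Set Implicit Arguments.
Unset Strict Implicit.
Unset Printing Implicit Defensive.

(* All the bounds come from one weak converse, which uses no differential entropy.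
   User i observes y_i = z_i + s, where s = alpha x_j + beta x_k depends on the past,
   and a genie gives it the noise z_j - rho z_i. If rho h_j = h_i then, once user i
   has decoded its messages and knows those of user j, it can simulate user j and
   decode the message from k to j as well; rho = 0 gives the multiple-access cut, and
   alpha = 0 with the messages of both i and j known the broadcast cut.
   The normalized noises z_i + rho z_j and z_j - rho z_i are independent standard
   Gaussians; the reference law Q replaces the first one, shifted by
   sqrt(1 + rho^2) s, by N(0, 1 + V), where V = (|alpha| + |beta|)^2 P (1 + rho^2).
   As (|alpha| + |beta|)^2 P bounds the power of s, the divergence of the n channel
   uses from Q is at most (n / 2) ln (1 + V). Under Q the observations are
   independent of the messages, so that M equally likely possibilities are guessed
   with probability at most 1 / M. The Donsker-Varadhan inequality
   E phi <= D + ln (E_Q exp phi), for phi = ln M times the indicator of correct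
   decoding, then gives (1 - error) ln M <= (n / 2) ln (1 + V) + 1. *)

(** * Gaussian integrals *)

Section gaussian.
Context {R : realType}.
Local Notation mu := (@lebesgue_measure R).
Local Notation RM := (measurableTypeR R).
Local Notation gam := (normal_prob (0 : R) 1).
Implicit Types (k b m s rho : R) (f : RM -> \bar R).

Lemma measurable_affine k b : measurable_fun setT (fun x : RM => k * x + b : RM).
Proof. by apply: measurable_funD => //; exact: measurable_funM. Qed.

(** By uniqueness of Lebesgue measure: the pushforward scaled by [k] gives half-open intervals their
    length. *)
Lemma lebesgue_measure_affine k b (A : set RM) : 0 < k -> measurable A ->
  mu A = (k%:E * mu ((fun x : RM => (k * x + b)%R) @^-1` A))%E.
Proof.
move=> k0 mA.
have mf := measurable_affine k b.
pose mf_mixin := isMeasurableFun.Build _ _ _ _ _ mf.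
pose F : {mfun RM >-> RM} := HB.pack (fun x : RM => k * x + b : RM) mf_mixin.
pose k' : {nonneg R} := NngNum (ltW k0).
rewrite (@lebesgue_measure_unique _ (mscale k' (pushforward mu F))) //.
move=> _ [[x y] /= xy <-]; rewrite /mscale /= /pushforward.
have -> : (fun x : RM => k * x + b) @^-1` `]x, y] = `](x - b) / k, (y - b) / k]%classic.
  apply/seteqP; split => z /=; rewrite !in_itv /=;
  by rewrite ltr_pdivrMr// ler_pdivlMr// (mulrC z) ltrBlDr lerBrDr.
rewrite !lebesgue_measure_itv /= !lte_fin ltr_pM2r ?invr_gt0// ltrD2r.
case: ifP => _; last by rewrite mule0.
by rewrite -!EFinB -EFinM; congr EFin; field; rewrite gt_eqF.
Qed.

Lemma ge0_integral_affine k b f : 0 < k -> measurable_fun setT f ->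
  (forall x, 0 <= f x)%E ->
  (\int[mu]_x f x = k%:E * \int[mu]_x f (k * x + b)%R)%E.
Proof.
move=> k0 mf f0.
pose F (x : RM) : RM := k * x + b.
have mF : measurable_fun setT F by exact: measurable_affine.
pose k' : {nonneg R} := NngNum (ltW k0).
have [nu nuE] : exists nu : {measure set RM -> \bar R}, nu = pushforward mu F :> (_ -> _).
  by unshelve eexists (pushforward mu F).
transitivity (\int[mscale k' nu]_x f x)%E.
  apply: eq_measure_integral => A mA _.
  by rewrite [LHS](lebesgue_measure_affine b k0 mA)// -/(pushforward mu F A) -nuE.
rewrite ge0_integral_mscale//; congr (_ * _)%E.
rewrite -[RHS](ge0_integral_pushforward mF mu measurableT) //.
by apply: eq_measure_integral => A mA _; rewrite nuE.
Qed.

(** The Radon-Nikodym derivative of the normal law and [normal_pdf] have the same integral over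
    every measurable set, hence agree almost everywhere. *)
Lemma ge0_integral_normal m s f : measurable_fun setT f ->
  (forall x, 0 <= f x)%E ->
  (\int[normal_prob m s]_x f x = \int[mu]_x (f x * (normal_pdf m s x)%:E))%E.
Proof.
move=> mf f0.
have dom := normal_prob_dominates m s.
rewrite -(Radon_Nikodym_SigmaFinite.change_of_variables dom)//.
have mpdf : measurable_fun setT (fun x : RM => (normal_pdf m s x)%:E).
  by apply/measurable_EFinP; exact: measurable_normal_pdf.
have iRN := Radon_Nikodym_SigmaFinite.f_integrable dom.
apply: ge0_ae_eq_integral => //.
- by apply: emeasurable_funM => //; exact: measurable_int iRN.
- exact: emeasurable_funM.
- by move=> x _; rewrite mule_ge0// Radon_Nikodym_SigmaFinite.f_ge0.
- by move=> x _; rewrite mule_ge0// lee_fin normal_pdf_ge0.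
apply: ae_eqe_mul2l; apply: integral_ae_eq => //.
by move=> E _ mE; rewrite -Radon_Nikodym_SigmaFinite.f_integral.
Qed.

(** The exponential factor is the likelihood ratio of N(-m, s^2) to N(0, 1) at x. *)
Lemma normal_pdf_ratio m s x : 0 < s ->
  normal_pdf 0 s (x + m) =
  expR (- (ln s + (x + m) ^+ 2 / (2 * s ^+ 2) - x ^+ 2 / 2)) * normal_pdf 0 1 x.
Proof.
move=> s0; rewrite !normal_pdfE ?oner_eq0 ?gt_eqF// /normal_fun.
have -> : normal_peak s = s^-1 * normal_peak 1.
  rewrite /normal_peak expr1n mul1r -mulrnAr sqrtrM ?sqr_ge0// sqrtr_sqr.
  by rewrite gtr0_norm// invfM.
rewrite (mulrC s^-1) -mulrA [RHS]mulrCA; congr (_ * _); rewrite -expRD.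
have -> : s^-1 = expR (- ln s) by rewrite expRN lnK.
rewrite -expRD; congr expR.
by field; rewrite gt_eqF.
Qed.

Lemma ge0_integral_opp f : measurable_fun setT f -> (forall x, 0 <= f x)%E ->
  (\int[mu]_x f (- x)%R = \int[mu]_x f x)%E.
Proof.
move=> mf f0.
have mN : measurable_fun setT (-%R : RM -> RM) by exact: oppr_measurable.
rewrite -[LHS](ge0_integral_pushforward mN mu measurableT) //.
by apply: eq_measure_integral => A mA _; exact: lebesgue_measureN.
Qed.

Lemma ge0_integral_normal_opp f : measurable_fun setT f -> (forall x, 0 <= f x)%E ->
  (\int[gam]_x f (- x)%R = \int[gam]_x f x)%E.
Proof.
move=> mf f0.
have mN : measurable_fun setT (-%R : RM -> RM) by exact: oppr_measurable.
rewrite !ge0_integral_normal//; last exact: measurableT_comp mf mN.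
pose g x := (f x * (normal_pdf 0 1 x)%:E)%E.
rewrite -[RHS](@ge0_integral_opp g); last first.
- by move=> x; rewrite mule_ge0// lee_fin normal_pdf_ge0.
- by apply: emeasurable_funM => //; apply/measurable_EFinP; exact: measurable_normal_pdf.
apply: eq_integral => x _; congr (_ * _%:E)%E.
by rewrite /= !normal_pdfE ?oner_eq0// /normal_fun !subr0 sqrrN.
Qed.

(** The exponential turns the standard density into [s] times the density of N(0, s^2), which has
    total mass 1. *)
Lemma normal_exp_square s : 0 < s ->
  (\int[gam]_x (expR ((1 - s ^- 2) / 2 * x ^+ 2))%:E = s%:E)%E.
Proof.
move=> s0.
have mx2 : measurable_fun setT (fun x : RM => (expR ((1 - s ^- 2) / 2 * x ^+ 2))%:E).
  apply/measurable_EFinP; apply: measurableT_comp => //.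
  by apply: measurable_funM => //; exact: measurable_funX.
rewrite ge0_integral_normal//.
transitivity (\int[mu]_x (s%:E * (normal_pdf 0 s x)%:E))%E.
  apply: eq_integral => x _; rewrite -!EFinM; congr EFin.
  have := normal_pdf_ratio 0 x s0; rewrite addr0 => ->.
  have sE : expR (ln s) = s by rewrite lnK.
  rewrite [RHS]mulrA; congr (_ * _); rewrite -[X in _ = X * _]sE -expRD; congr expR.
  by field; rewrite gt_eqF.
rewrite ge0_integralZl_EFin ?(ltW s0)//; first by rewrite integral_normal_pdf mule1.
- by move=> x _; rewrite lee_fin normal_pdf_ge0.
- by apply/measurable_EFinP; exact: measurable_normal_pdf.
Qed.

(* The bound [1 + u <= expR u] in [normal_exp_square], with s tending to 1 from
   above and from below. *)
Lemma normal_second_moment : (\int[gam]_x (x ^+ 2)%:E = 1)%E.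
Proof.
have mx2 : measurable_fun setT (fun x : RM => (x ^+ 2)%:E).
  by apply/measurable_EFinP; exact: measurable_funX.
set e := integral _ _ _.
have e0 : (0 <= e)%E by apply: integral_ge0 => x _; rewrite lee_fin sqr_ge0.
have cst1 : (\int[gam]_x 1 = 1 :> \bar R)%E.
  by rewrite integral_cst//= probability_setT mule1.
(* For s > 1 the coefficient of x^2 is nonnegative, and the exponential bound integrates directly to
   an upper bound on the moment. *)
have up s : 1 < s -> (1 + ((1 - s ^- 2) / 2)%:E * e <= s%:E)%E.
  move=> s1; have s0 : 0 < s by apply: lt_trans s1.
  have k0 : 0 <= (1 - s ^- 2) / 2.
    by rewrite divr_ge0// subr_ge0 invf_le1 ?exprn_gt0// exprn_ege1// ltW.
  rewrite -(normal_exp_square s0) -cst1 /e -ge0_integralZl_EFin//; last first.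
    by move=> x _; rewrite lee_fin sqr_ge0.
  rewrite -ge0_integralD//; last 2 first.
  - by move=> x _; rewrite -EFinM lee_fin mulr_ge0// sqr_ge0.
  - exact: emeasurable_funM.
  apply: ge0_le_integral => //.
  - by move=> x _; rewrite adde_ge0// -EFinM lee_fin mulr_ge0// sqr_ge0.
  - by apply: emeasurable_funD => //; exact: emeasurable_funM.
  - apply/measurable_EFinP; apply: measurableT_comp => //.
    by apply: measurable_funM => //; exact: measurable_funX.
  - by move=> x _; rewrite -EFinM -EFinD lee_fin expR_ge1Dx.
(* For s < 1 the coefficient is negative; its term is moved to the other side, so that all
   integrands stay nonnegative, and the moment is bounded from below. *)
have lo s : 0 < s -> s < 1 -> (1 <= s%:E + ((s ^- 2 - 1) / 2)%:E * e)%E.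
  move=> s0 s1.
  have k0 : 0 <= (s ^- 2 - 1) / 2.
    by rewrite divr_ge0// subr_ge0 invf_ge1 ?exprn_gt0// exprn_ile1// ltW.
  rewrite -(normal_exp_square s0) -cst1 /e -ge0_integralZl_EFin//; last first.
    by move=> x _; rewrite lee_fin sqr_ge0.
  have mexp : measurable_fun setT (fun x : RM => (expR ((1 - s ^- 2) / 2 * x ^+ 2))%:E).
    apply/measurable_EFinP; apply: measurableT_comp => //.
    by apply: measurable_funM => //; exact: measurable_funX.
  rewrite -ge0_integralD//; last 2 first.
  - by move=> x _; rewrite -EFinM lee_fin mulr_ge0// sqr_ge0.
  - exact: emeasurable_funM.
  apply: ge0_le_integral => //.
  - by apply: emeasurable_funD => //; exact: emeasurable_funM.
  - move=> x _; rewrite -EFinM -EFinD lee_fin.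
    apply: le_trans (lerD (expR_ge1Dx _) (lexx _)).
    by rewrite -addrA lerDl -mulrDl; lra.
(* At s = 2 the coefficient in [up] is positive, which rules out an infinite moment. *)
have efin : e \is a fin_num.
  rewrite ge0_fin_numE// ltNge leye_eq; apply/negP => /eqP ey.
  have := up 2; rewrite ey ltr1n => /(_ isT).
  rewrite gt0_muley ?addey//; rewrite lte_fin; lra.
move: up lo e0; rewrite -(fineK efin); move: (fine e) => r up lo; rewrite lee_fin => r0.
(* Here s = 1 + t, and s = 1 - t in [lo']. The slopes 3 and 2 are crude: 2 (1 + t)^2 <= (2 + t) (1 +
   3 t) and (2 - t) (1 - 2 t) <= 2 (1 - t)^2. *)
have up' t : 0 < t -> t < 1 -> r <= 1 + 3 * t.
  move=> t0 t1; have := up (1 + t); rewrite ltrDl => /(_ t0).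
  rewrite -EFinM -EFinD lee_fin.
  have -> : 1 + (1 - (1 + t) ^- 2) / 2 * r = 1 + t * ((2 + t) * r / (2 * (1 + t) ^+ 2)).
    by field; rewrite gt_eqF// addr_gt0.
  rewrite lerD2l ger_pMr// ler_pdivrMr ?mul1r; last by rewrite mulr_gt0// exprn_gt0// addr_gt0.
  move=> h; rewrite -(@ler_pM2l _ (2 + t)); last by rewrite addr_gt0.
  apply: le_trans h _; nra.
have lo' t : 0 < t -> t < 1 -> 1 - 2 * t <= r.
  move=> t0 t1; have := lo (1 - t); rewrite subr_gt0 gtrBl => /(_ t1 t0).
  rewrite -EFinM -EFinD lee_fin.
  have t10 : 1 - t != 0 by rewrite gt_eqF// subr_gt0.
  have -> : 1 - t + ((1 - t) ^- 2 - 1) / 2 * r = 1 + t * (- 1 + (2 - t) * r / (2 * (1 - t) ^+ 2)).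
    by field.
  rewrite lerDl pmulr_rge0// addrC subr_ge0 ler_pdivlMr ?mul1r; last first.
    by rewrite mulr_gt0// exprn_gt0// subr_gt0.
  move=> h; rewrite -(@ler_pM2l _ (2 - t)); last by rewrite subr_gt0; lra.
  apply: le_trans h; nra.
congr EFin; apply/eqP; rewrite eq_le; apply/andP; split; apply/ler_addgt0Pl => d d0;
  pose t := Num.min (d / 3) (1 / 2);
  have t0 : 0 < t by [rewrite lt_min !divr_gt0];
  have t1 : t < 1 by [rewrite gt_min; apply/orP; right; lra];
  have td : t <= d / 3 by [rewrite ge_min lexx].
  by apply: le_trans (up' _ t0 t1) _; lra.
by have := lo' _ t0 t1; lra.
Qed.

End gaussian.

(** * Integrals over product probabilities *)

Section product_probability.
Context d1 d2 (T1 : measurableType d1) (T2 : measurableType d2) {R : realType}.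
Context (P1 : probability T1 R) (P2 : probability T2 R).

Definition prod_prob : probability (T1 * T2)%type R := (P1 \x P2)%E.

Lemma ge0_integral_prod_prob (f : T1 * T2 -> \bar R) : measurable_fun setT f ->
  (forall v, 0 <= f v)%E ->
  (\int[prod_prob]_v f v = \int[P1]_x \int[P2]_y f (x, y))%E.
Proof. exact: fubini_tonelli1. Qed.

Lemma measurable_integral_snd (f : T1 * T2 -> \bar R) : measurable_fun setT f ->
  (forall v, 0 <= f v)%E -> measurable_fun setT (fun x => \int[P2]_y f (x, y))%E.
Proof. by move=> mf f0; exact: measurable_fun_fubini_tonelli_F. Qed.

End product_probability.

(** * The Donsker-Varadhan inequality *)

Section log_mgf.
Context d (T : measurableType d) {R : realType} (P : probability T R).
Implicit Types (psi : T -> R) (a : R).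

(** The reference term of the Donsker-Varadhan inequality. [fine] loses nothing on measurable test
    functions with values in some [0, a]. *)
Definition log_mgf psi : R := ln (fine (\int[P]_x (expR (psi x))%:E)).

Lemma integral_probability_cst a : (\int[P]_x a%:E = a%:E)%E.
Proof. by rewrite integral_cst//= probability_setT mule1. Qed.

Lemma probability_integral_bounds psi a1 a2 : measurable_fun setT psi ->
  0 <= a1 -> (forall x, a1 <= psi x <= a2) ->
  (a1%:E <= \int[P]_x (psi x)%:E <= a2%:E)%E.
Proof.
move=> mpsi a10 psia.
have psi0 x : 0 <= psi x by have /andP[+ _] := psia x; exact: le_trans.
have mE : measurable_fun setT (fun x => (psi x)%:E) by exact/measurable_EFinP.
rewrite -(integral_probability_cst a1) -(integral_probability_cst a2).
apply/andP; split; apply: ge0_le_integral => //.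
- by move=> x _; rewrite lee_fin; have /andP[] := psia x.
- by move=> x _; rewrite lee_fin.
- by move=> x _; rewrite lee_fin; have /andP[] := psia x.
Qed.

Lemma expR_bounds psi a : (forall x, 0 <= psi x <= a) -> forall x, 1 <= expR (psi x) <= expR a.
Proof. by move=> psia x; have /andP[? ?] := psia x; rewrite -expR0 !ler_expR; apply/andP. Qed.

Lemma log_mgf_bounds psi a : measurable_fun setT psi ->
  (forall x, 0 <= psi x <= a) -> 0 <= log_mgf psi <= a.
Proof.
move=> mpsi psia; have mexp := measurableT_comp (@measurable_expR R) mpsi.
have := probability_integral_bounds mexp ler01 (expR_bounds psia).
rewrite /log_mgf; case: integral => [r /=||]; rewrite ?leey_eq ?andbF// !lee_fin => /andP[r1 ra].
have r0 : 0 < r by apply: lt_le_trans r1.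
by rewrite ln_ge0//= -ler_expR lnK.
Qed.

Lemma expR_log_mgf psi a : measurable_fun setT psi ->
  (forall x, 0 <= psi x <= a) ->
  ((expR (log_mgf psi))%:E = \int[P]_x (expR (psi x))%:E)%E.
Proof.
move=> mpsi psia; have mexp := measurableT_comp (@measurable_expR R) mpsi.
have := probability_integral_bounds mexp ler01 (expR_bounds psia).
rewrite /log_mgf; case: integral => [r /=||]; rewrite ?leey_eq ?andbF// !lee_fin => /andP[r1 ra].
by rewrite lnK// posrE (lt_le_trans _ r1).
Qed.

(** Jensen's inequality, by integrating 1 + u <= expR u at u = psi - b, where b is the [log_mgf], so
    that expR (psi - b) has mean 1. *)
Lemma mean_le_log_mgf psi a : measurable_fun setT psi ->
  (forall x, 0 <= psi x <= a) -> (\int[P]_x (psi x)%:E <= (log_mgf psi)%:E)%E.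
Proof.
move=> mpsi psia; have mexp := measurableT_comp (@measurable_expR R) mpsi.
have psi0 x : 0 <= psi x by have /andP[] := psia x.
have /andP[b0 _] := log_mgf_bounds mpsi psia.
have bE := expR_log_mgf mpsi psia.
move: b0 bE; set b := log_mgf psi => b0 bE.
have mE : measurable_fun setT (fun x => (psi x)%:E) by exact/measurable_EFinP.
have mexpE : measurable_fun setT (fun x => (expR (- b) * expR (psi x))%:E).
  by apply/measurable_EFinP; exact: measurable_funM.
have Eexp : (\int[P]_x (expR (- b) * expR (psi x))%:E = 1)%E.
  transitivity ((expR (- b))%:E * \int[P]_x (expR (psi x))%:E)%E.
    rewrite -ge0_integralZl_EFin ?expR_ge0//; exact/measurable_EFinP.
  by rewrite -bE -EFinM -expRD addNr expR0.
rewrite -(@leeD2rE _ 1%:E)// -{1}(integral_probability_cst 1) -ge0_integralD//; last first.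
  by move=> x _; rewrite lee_fin.
rewrite -{2}Eexp -(integral_probability_cst b) -ge0_integralD//.
apply: ge0_le_integral => //.
- by move=> x _; rewrite adde_ge0// lee_fin psi0.
- exact: emeasurable_funD.
- exact: emeasurable_funD.
- move=> x _; rewrite -!EFinD lee_fin -expRD.
  by have := expR_ge1Dx (- b + psi x); lra.
Qed.

(** Measurability in the parameter lets the [log_mgf] over one coordinate serve as a test function
    of the other. *)
Lemma measurable_log_mgf d' (T' : measurableType d') (f : T' * T -> R) :
  measurable_fun setT f -> measurable_fun setT (fun x => log_mgf (fun t => f (x, t))).
Proof.
move=> mf; apply: measurableT_comp; first exact: measurable_ln.
apply: measurableT_comp; first exact: fine_measurable.
apply: (measurable_integral_snd P (f := fun x => (expR (f x))%:E)) => //.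
by apply/measurable_EFinP/measurableT_comp.
Qed.

End log_mgf.

Section gaussian_donsker_varadhan.
Context {R : realType}.
Local Notation mu := (@lebesgue_measure R).
Local Notation RM := (measurableTypeR R).
Local Notation gam := (normal_prob (0 : R) 1).
Implicit Types (m s a rho : R).

(** Averaging over x and -x removes the cross term 2 m x, so that no signed function is
    integrated. *)
Lemma normal_mean_sqr_shift m : (\int[gam]_x ((x + m) ^+ 2)%:E = (1 + m ^+ 2)%:E)%E.
Proof.
have mf : measurable_fun setT (fun x : RM => ((x + m) ^+ 2)%:E).
  by apply/measurable_EFinP; apply: measurable_funX; exact: measurable_funD.
have mfN : measurable_fun setT (fun x : RM => ((- x + m) ^+ 2)%:E).
  apply/measurable_EFinP; apply: measurable_funX; apply: measurable_funD => //.
have mx2 : measurable_fun setT (fun x : RM => (x ^+ 2)%:E).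
  by apply/measurable_EFinP; exact: measurable_funX.
have f0 (x : RM) : (0 <= ((x + m) ^+ 2)%:E)%E by rewrite lee_fin sqr_ge0.
have : (2%:E * \int[gam]_x ((x + m) ^+ 2)%:E = 2%:E * (1 + m ^+ 2)%:E)%E.
  rewrite mule_natl mule2n -{2}(ge0_integral_normal_opp mf f0) -ge0_integralD//.
  transitivity (\int[gam]_x (2%:E * (x ^+ 2)%:E + (2 * m ^+ 2)%:E))%E.
    by apply: eq_integral => x _; rewrite -EFinM -!EFinD; congr EFin; ring.
  rewrite ge0_integralD//; last 3 first.
  - by move=> x _; rewrite -EFinM lee_fin mulr_ge0// sqr_ge0.
  - exact: emeasurable_funM.
  - by move=> x _; rewrite lee_fin mulr_ge0// sqr_ge0.
  rewrite integral_probability_cst ge0_integralZl_EFin//; last by move=> x _; rewrite lee_fin sqr_ge0.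
  by rewrite normal_second_moment mule1 -EFinM -EFinD; congr EFin; ring.
by move/(congr1 (fun e => 2^-1%:E * e)%E); rewrite !muleA -EFinM mulVf// !mul1e.
Qed.

(* The Kullback-Leibler divergence D(N(0, 1) || N(- m, s ^ 2)). *)
Definition normal_cost s m : R := ln s + ((1 + m ^+ 2) / s ^+ 2 - 1) / 2.

(* With L the log-likelihood ratio of N(0, 1) to N(- m, s ^ 2) and b the value of
   [log_mgf], integrate [psi - L <= b - 1 + expR (psi - L - b)]. *)
Lemma normal_donsker_varadhan m s (psi : RM -> R) a : 1 <= s ->
  measurable_fun setT psi -> (forall x, 0 <= psi x <= a) ->
  (\int[gam]_x (psi x)%:E <=
   (normal_cost s m + log_mgf (normal_prob 0 s) (fun v : RM => psi (v - m)))%:E)%E.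
Proof.
move=> s1 mpsi psia.
have s0 : 0 < s by apply: lt_le_trans s1.
have ms : measurable_fun setT (fun v : RM => v - m : RM) by exact: measurable_funB.
have mpsim : measurable_fun setT (fun v : RM => psi (v - m)) by exact: measurableT_comp mpsi ms.
have psi0 x : 0 <= psi x by have /andP[] := psia x.
set b := log_mgf _ _.
have /andP[b0 _] : 0 <= b <= a by exact: log_mgf_bounds.
have bE : ((expR b)%:E = \int[normal_prob 0 s]_v (expR (psi (v - m)))%:E)%E by exact: expR_log_mgf.
pose L (x : RM) := ln s + (x + m) ^+ 2 / (2 * s ^+ 2) - x ^+ 2 / 2.
have mL : measurable_fun setT L.
  apply: measurable_funB; last by apply: measurable_funM => //; exact: measurable_funX.
  apply: measurable_funD => //; apply: measurable_funM => //; apply: measurable_funX.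
  exact: measurable_funD.
have mexpL : measurable_fun setT (fun x => (expR (psi x - L x))%:E).
  by apply/measurable_EFinP/measurableT_comp => //; exact: measurable_funB.
(* Change of measure: weighting by expR (- L) and translating by m turns N(0, 1) into N(0, s^2). *)
have EL : (\int[gam]_x (expR (psi x - L x))%:E = (expR b)%:E)%E.
  have mexpm : measurable_fun setT (fun v : RM => (expR (psi (v - m)))%:E).
    exact/measurable_EFinP/measurableT_comp.
  rewrite bE (@ge0_integral_normal _ 0 1 _ mexpL); last by move=> x; rewrite lee_fin expR_ge0.
  rewrite (@ge0_integral_normal _ 0 s _ mexpm); last by move=> x; rewrite lee_fin expR_ge0.
  rewrite [RHS](@ge0_integral_affine _ 1 m)//; last 2 first.
  - by apply: emeasurable_funM => //; apply/measurable_EFinP; exact: measurable_normal_pdf.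
  - by move=> x; rewrite -EFinM lee_fin mulr_ge0 ?expR_ge0// normal_pdf_ge0.
  rewrite mul1e; apply: eq_integral => x _; rewrite mul1r addrK normal_pdf_ratio//.
  by rewrite -!EFinM mulrA -expRD.
have mx2 : measurable_fun setT (fun x : RM => (x ^+ 2 / 2)%:E).
  by apply/measurable_EFinP; apply: measurable_funM => //; exact: measurable_funX.
have mxm2 : measurable_fun setT (fun x : RM => ((x + m) ^+ 2 / (2 * s ^+ 2))%:E).
  apply/measurable_EFinP; apply: measurable_funM => //; apply: measurable_funX.
  exact: measurable_funD.
have half c (f : RM -> R) : 0 <= c -> measurable_fun setT f -> (forall x, 0 <= f x) ->
    (\int[gam]_x (f x * c)%:E = \int[gam]_x (f x)%:E * c%:E)%E.
  move=> c0 mf f0; under eq_integral do rewrite EFinM.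
  by rewrite ge0_integralZr//; [exact/measurable_EFinP|move=> x _; rewrite lee_fin f0].
have mE : measurable_fun setT (fun x => (psi x)%:E) by exact/measurable_EFinP.
(* The pointwise inequality with its negative terms moved across, so that only nonnegative functions
   are integrated; s >= 1 makes ln s one of them. *)
have key : (\int[gam]_x ((psi x)%:E + (x ^+ 2 / 2)%:E + 1%:E) <=
  \int[gam]_x ((ln s + b)%:E + ((x + m) ^+ 2 / (2 * s ^+ 2))%:E +
     (expR (psi x - L x) * expR (- b))%:E))%E.
  apply: ge0_le_integral => //.
  - move=> x _; rewrite -!EFinD lee_fin !addr_ge0//.
    by rewrite mulr_ge0// sqr_ge0.
  - apply: emeasurable_funD => //; first exact: emeasurable_funD.
  - apply: emeasurable_funD; first exact: emeasurable_funD.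
    by apply/measurable_EFinP; apply: measurable_funM => //; exact/measurable_EFinP.
  - move=> x _; rewrite -!EFinD lee_fin -expRD.
    have := expR_ge1Dx (psi x - L x - b); rewrite /L; lra.
have ls0 : 0 <= ln s by rewrite ln_ge0.
have c0 (x : RM) : 0 <= (x + m) ^+ 2 / (2 * s ^+ 2).
  by rewrite divr_ge0 ?sqr_ge0// mulr_ge0// sqr_ge0.
move: key.
rewrite !ge0_integralD//; last 9 first.
- by move=> x _; rewrite lee_fin addr_ge0.
- by move=> x _; rewrite lee_fin c0.
- by move=> x _; rewrite -EFinD lee_fin !addr_ge0// c0.
- exact: emeasurable_funD.
- by apply/measurable_EFinP; apply: measurable_funM => //; exact/measurable_EFinP.
- by move=> x _; rewrite lee_fin psi0.
- by move=> x _; rewrite lee_fin mulr_ge0// sqr_ge0.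
- by move=> x _; rewrite -EFinD lee_fin !addr_ge0// mulr_ge0// sqr_ge0.
- exact: emeasurable_funD.
rewrite !integral_probability_cst.
rewrite (half 2^-1 (fun x => x ^+ 2))//; last by move=> x; exact: sqr_ge0.
rewrite (half (2 * s ^+ 2)^-1 (fun x => (x + m) ^+ 2))//; last 3 first.
- by rewrite invr_ge0 mulr_ge0// sqr_ge0.
- by apply: measurable_funX; exact: measurable_funD.
- by move=> x; exact: sqr_ge0.
rewrite (half (expR (- b)) (fun x => expR (psi x - L x)))//; last exact/measurable_EFinP.
rewrite EL normal_second_moment normal_mean_sqr_shift.
rewrite -!EFinM -expRD subrr expR0 mul1r.
have /andP[] := probability_integral_bounds gam mpsi (lexx _) psia.
case: integral => [r||]//= _ _; rewrite -!EFinD !lee_fin /normal_cost.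
have -> : (1 + m ^+ 2) / (2 * s ^+ 2) = (1 + m ^+ 2) / s ^+ 2 / 2 by field; rewrite gt_eqF.
lra.
Qed.

(** Jensen replaces the mean over the second coordinate by its [log_mgf], which becomes the test
    function of the scalar inequality. The second coordinate keeps its law and costs nothing. *)
Lemma normal_pair_donsker_varadhan d (T : measurableType d) (P : probability T R)
    m s (psi : RM * T -> R) a : 1 <= s ->
  measurable_fun setT psi -> (forall x, 0 <= psi x <= a) ->
  (\int[prod_prob gam P]_x (psi x)%:E <=
   (normal_cost s m +
    log_mgf (prod_prob (normal_prob 0 s) P) (fun v : RM * T => psi (v.1 - m, v.2)))%:E)%E.
Proof.
move=> s1 mpsi psia.
have psi0 x : 0 <= psi x by have /andP[] := psia x.
have mE : measurable_fun setT (fun x => (psi x)%:E) by exact/measurable_EFinP.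
have msec x : measurable_fun setT (fun t => psi (x, t)) by exact: measurableT_comp mpsi (measurable_pair1 x).
have mF : measurable_fun setT (fun x : RM => log_mgf P (fun t => psi (x, t))).
  exact: measurable_log_mgf.
have Fa x : 0 <= log_mgf P (fun t => psi (x, t)) <= a.
  exact: log_mgf_bounds (msec x) (fun t => psia _).
rewrite ge0_integral_prod_prob//.
apply: (@le_trans _ _ (\int[gam]_x (log_mgf P (fun t => psi (x, t)))%:E)%E).
  apply: ge0_le_integral => //.
  - by move=> x _; apply: integral_ge0 => t _; rewrite lee_fin.
  - exact: (measurable_integral_snd P (f := fun x => (psi x)%:E)).
  - exact/measurable_EFinP.
  - by move=> x _; exact: mean_le_log_mgf (msec x) (fun t => psia _).
apply: (le_trans (normal_donsker_varadhan m s1 mF Fa)).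
rewrite lee_fin lerD2l {1 3}/log_mgf.
rewrite [X in ln (fine X) <= _](_ : _ =
  \int[prod_prob (normal_prob 0 s) P]_v (expR (psi (v.1 - m, v.2)))%:E)%E//.
have msh : measurable_fun setT (fun v : RM * T => (v.1 - m : RM, v.2)).
  by apply: measurable_fun_pair => //; apply: measurable_funB => //.
rewrite ge0_integral_prod_prob//; last first.
  by apply/measurable_EFinP/measurableT_comp => //; exact: measurableT_comp mpsi msh.
by apply: eq_integral => x _; exact: expR_log_mgf (msec (x - m)) (fun t => psia _).
Qed.

End gaussian_donsker_varadhan.

(** * Integrals over i.i.d. samples *)

Section iid_integral.
Local Open Scope ereal_scope.
Context d (T : measurableType d) {R : realType} (P : probability T R).

Lemma ge0_integral_iid0 (f : 0.-tuple T -> \bar R) : measurable_fun setT f ->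
  \int[iid P 0]_x f x = f [tuple].
Proof. by move=> mf; rewrite integral_dirac// diracT mul1e. Qed.

Lemma ge0_integral_iidS n (f : n.+1.-tuple T -> \bar R) :
  measurable_fun setT f -> (forall x, 0 <= f x) ->
  \int[iid P n.+1]_x f x = \int[P]_x \int[iid P n]_y f (cons_pair (x, y)).
Proof.
move=> mf f0; rewrite [LHS]ge0_integral_distribution//.
rewrite fubini_tonelli1//; last by move=> x; exact: f0.
exact: measurableT_comp mf (@measurable_cons_pair _ _ _).
Qed.

End iid_integral.

(** * Permuting and rotating the noise of one channel use *)

Section tonelli3.
Local Open Scope ereal_scope.
Context d1 d2 d3 (T1 : measurableType d1) (T2 : measurableType d2) (T3 : measurableType d3).
Context {R : realType} (P1 : probability T1 R) (P2 : probability T2 R) (P3 : probability T3 R).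
Variable f : T1 * (T2 * T3) -> \bar R.
Hypotheses (mf : measurable_fun setT f) (f0 : forall x, 0 <= f x).

Lemma tonelli3 : \int[prod_prob P1 (prod_prob P2 P3)]_v f v =
  \int[P1]_x \int[P2]_y \int[P3]_z f (x, (y, z)).
Proof.
rewrite ge0_integral_prod_prob//; apply: eq_integral => x _.
rewrite ge0_integral_prod_prob//.
exact: measurableT_comp mf (measurable_pair1 x).
Qed.

Lemma tonelli3_swap23 : \int[prod_prob P1 (prod_prob P2 P3)]_v f v =
  \int[P1]_x \int[P3]_z \int[P2]_y f (x, (y, z)).
Proof.
rewrite tonelli3; apply: eq_integral => x _.
rewrite (fubini_tonelli (fun p => f (x, p)))//.
exact: measurableT_comp mf (measurable_pair1 x).
Qed.

Lemma tonelli3_swap12 : \int[prod_prob P1 (prod_prob P2 P3)]_v f v =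
  \int[P2]_y \int[P1]_x \int[P3]_z f (x, (y, z)).
Proof.
rewrite tonelli3 (fubini_tonelli (fun p => \int[P3]_z f (p.1, (p.2, z))))//.
- apply: (measurable_integral_snd P3
    (f := fun p : (T1 * T2) * T3 => f (p.1.1, (p.1.2, p.2)))) => //.
  apply: measurableT_comp => //; apply: measurable_fun_pair.
    exact: measurableT_comp measurable_fst measurable_fst.
  apply: measurable_fun_pair => //.
  exact: measurableT_comp measurable_snd measurable_fst.
- by move=> p; apply: integral_ge0.
Qed.

End tonelli3.

Lemma userP (i : user) : [\/ i = 0, i = 1 | i = 2].
Proof.
by case: i => [[|[|[|?]]] ?] //;
  [apply: Or31|apply: Or32|apply: Or33]; exact: val_inj.
Qed.

Lemma third_user (a b c i : user) : a != b -> a != c -> b != c -> i != a -> i != b -> i = c.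
Proof.
by case: a b c i => [[|[|[|?]]] ?] [[|[|[|?]]] ?] [[|[|[|?]]] ?] [[|[|[|?]]] ?] // *; exact: val_inj.
Qed.

Section noise_triple.
Context {R : realType}.
Local Notation RM := (measurableTypeR R).
Local Notation gam := (normal_prob (0 : R) 1).
Implicit Types (a b c : user) (m s rho : R).

(** Lets arbitrary users [a] and [b] play the observer and the user simulated with the genie's help;
    the third user takes the remaining noise. *)
Definition place a b (v : RM * (RM * RM)) : 3.-tuple RM :=
  [tuple (if i == a :> user then v.1 else if i == b :> user then v.2.1 else v.2.2) | i < 3].

Lemma measurable_place a b : measurable_fun setT (place a b).
Proof.
apply/measurable_fun_tnthP => i.
have -> : (@tnth 3 RM)^~ i \o place a b = fun v : RM * (RM * RM) =>
    if i == a :> user then v.1 else if i == b :> user then v.2.1 else v.2.2.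
  by apply/funext => v; rewrite /= tnth_mktuple.
case: (i == a :> user); first exact: measurable_fst.
case: (i == b :> user).
  exact: (measurableT_comp (@measurable_fst _ _ RM RM) (@measurable_snd _ _ RM (RM * RM)%type)).
exact: (measurableT_comp (@measurable_snd _ _ RM RM) (@measurable_snd _ _ RM (RM * RM)%type)).
Qed.

Section permutation.
Context (f : 3.-tuple RM -> \bar R).
Hypotheses (mf : measurable_fun setT f) (f0 : forall x, (0 <= f x)%E).

Let J a b := (\int[prod_prob gam (prod_prob gam gam)]_v f (place a b v))%E.

Let JE a b : J a b =
  (\int[gam]_x \int[gam]_y \int[gam]_w f (place a b (x, (y, w))))%E.
Proof.
have mfp := measurableT_comp mf (measurable_place a b).
exact: (tonelli3 gam gam gam mfp (fun v => f0 _)).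
Qed.

Let J_id : (\int[iid gam 3]_z f z)%E = J 0 1.
Proof.
have mc n (x : RM) : measurable_fun setT (fun l : n.-tuple RM => cons_pair (x, l)).
  exact: measurableT_comp (@measurable_cons_pair _ _ _) (measurable_pair1 x).
rewrite JE (ge0_integral_iidS gam mf f0); apply: eq_integral => x _.
have mf1 := measurableT_comp mf (mc _ x).
rewrite (ge0_integral_iidS gam mf1 (fun l => f0 _)); apply: eq_integral => y _.
have mf2 := measurableT_comp mf1 (mc _ y).
rewrite (ge0_integral_iidS gam mf2 (fun l => f0 _)); apply: eq_integral => w _.
have mf3 := measurableT_comp mf2 (mc _ w).
rewrite (ge0_integral_iid0 gam mf3) /=; congr f; apply: eq_from_tnth => i.
rewrite tnth_mktuple (tnth_nth 0).
by case: i => [[|[|[|?]]] ?].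
Qed.

Let J_swap12 a b : a != b -> J a b = J b a.
Proof.
have mfp := measurableT_comp mf (measurable_place b a).
move=> ab; rewrite JE /J (tonelli3_swap12 gam gam gam mfp (fun v => f0 _)).
do 3 (apply: eq_integral => ? _); congr f; apply: eq_from_tnth => i; rewrite !tnth_mktuple /=.
have [->|//] := eqVneq (i : user) a.
by rewrite (negbTE ab).
Qed.

Let J_swap23 a b c : a != b -> a != c -> b != c -> J a b = J a c.
Proof.
have mfp := measurableT_comp mf (measurable_place a c).
move=> ab ac bc; rewrite JE /J (tonelli3_swap23 gam gam gam mfp (fun v => f0 _)).
do 3 (apply: eq_integral => ? _); congr f; apply: eq_from_tnth => i; rewrite !tnth_mktuple /=.
case: eqP => // /eqP ia.
have [ib|ib] := eqVneq (i : user) b; first by rewrite ib (negbTE bc).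
by rewrite (third_user ab ac bc ia ib) eqxx.
Qed.

(** The exchanges of the first two and of the last two coordinates, both by Tonelli, reach all six
    placements from that of users 0 and 1. *)
Lemma ge0_integral_noise a b : a != b ->
  (\int[iid gam 3]_z f z = \int[prod_prob gam (prod_prob gam gam)]_v f (place a b v))%E.
Proof.
have nz : ((0 : user) != 1) /\ ((0 : user) != 2) /\ ((1 : user) != 2) by [].
case: nz => [n01 [n02 n12]].
have J01 := J_id.
have J02 : J 0 1 = J 0 2 := J_swap23 n01 n02 n12.
have J10 : J 0 1 = J 1 0 := J_swap12 n01.
have J20 : J 0 2 = J 2 0 := J_swap12 n02.
have n10 : (1 : user) != 0 by [].
have n20 : (2 : user) != 0 by [].
have n21 : (2 : user) != 1 by [].
have J12 : J 1 0 = J 1 2 := J_swap23 n10 n12 n02.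
have J21 : J 2 0 = J 2 1 := J_swap23 n20 n21 n01.
rewrite J01 => ab; suff -> : J 0 1 = J a b by [].
by move: ab; case: (userP a) => ->; case: (userP b) => -> ab;
  [by rewrite eqxx in ab | exact: erefl | exact: J02 | exact: J10
  | by rewrite eqxx in ab | exact: etrans J10 J12 | exact: etrans J02 J20
  | exact: etrans J02 (etrans J20 J21) | by rewrite eqxx in ab].
Qed.

End permutation.

Local Notation mu := (@lebesgue_measure R).

(** The joint density of two standard Gaussians is radial. *)
Lemma normal_pdf_mul (x y x' y' : R) : x ^+ 2 + y ^+ 2 = x' ^+ 2 + y' ^+ 2 ->
  normal_pdf 0 1 x * normal_pdf 0 1 y = normal_pdf 0 1 x' * normal_pdf 0 1 y'.
Proof.
have pdfE (z : R) : normal_pdf 0 1 z = normal_peak 1 * expR (- z ^+ 2 / 2).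
  by rewrite normal_pdfE ?oner_eq0// /normal_fun subr0 expr1n.
move=> xy; rewrite !pdfE [LHS]mulrACA [RHS]mulrACA -!expRD.
by rewrite -!mulrDl -!opprD xy.
Qed.

Lemma integral_normal_pair (f : RM * RM -> \bar R) : measurable_fun setT f ->
  (forall v, 0 <= f v)%E ->
  (\int[prod_prob gam gam]_v f v = \int[mu]_x \int[mu]_y
     (f (x, y) * (normal_pdf 0 1 x * normal_pdf 0 1 y)%:E))%E.
Proof.
move=> mf f0.
have mpdf : measurable_fun setT (fun x : RM => (normal_pdf (0 : R) 1 x)%:E).
  by apply/measurable_EFinP; exact: measurable_normal_pdf.
have pdf0 (x : R) : (0 <= (normal_pdf 0 1 x)%:E)%E by rewrite lee_fin normal_pdf_ge0.
have mfx x : measurable_fun setT (fun y => f (x, y)).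
  exact: measurableT_comp mf (measurable_pair1 x).
rewrite (ge0_integral_prod_prob gam gam mf f0).
rewrite (ge0_integral_normal 0 1 (measurable_integral_snd gam mf f0)); last first.
  by move=> x; apply: integral_ge0 => y _; exact: f0.
apply: eq_integral => x _.
rewrite (ge0_integral_normal 0 1 (mfx x) (fun y => f0 _)).
rewrite -(ge0_integralZr mu measurableT _ (fun y _ => _) (pdf0 x)); last 2 first.
- by apply: emeasurable_funM => //; exact: mfx.
- by move=> y _; rewrite mule_ge0.
by apply: eq_integral => y _; rewrite -muleA -EFinM [X in (_ * X%:E)%E]mulrC.
Qed.

(** The rotation factors into two one-variable affine substitutions, y to r y + rho x and then x to
    (x - rho y) / r, with Tonelli in between. Their Jacobians r and 1 / r cancel, and the density is
    invariant. *)
Lemma normal_rotation rho (f : RM * RM -> \bar R) : measurable_fun setT f ->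
  (forall x, 0 <= f x)%E -> let r := Num.sqrt (1 + rho ^+ 2) in
  (\int[prod_prob gam gam]_v f v =
   \int[prod_prob gam gam]_v f ((v.1 - rho * v.2) / r, (rho * v.1 + v.2) / r)%R)%E.
Proof.
move=> mf f0 r.
have r20 : 0 < 1 + rho ^+ 2 by rewrite ltr_pwDl// sqr_ge0.
have r0 : 0 < r by rewrite sqrtr_gt0.
have rr : r ^+ 2 = 1 + rho ^+ 2 by rewrite sqr_sqrtr// ltW.
have rn0 : r != 0 by rewrite gt_eqF.
have rV0 : 0 < r^-1 by rewrite invr_gt0.
have rrV e : (r%:E * (r^-1%:E * e) = e)%E by rewrite muleA -EFinM divff// mul1e.
have e1 (x y : R) : r^-1 * x - r^-1 * rho * y = (x - rho * y) / r by field.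
have e2 (x y : R) : r * y + rho * ((x - rho * y) / r) = (rho * x + y) / r.
  have -> : rho * x + y = rho * x + (r ^+ 2 - rho ^+ 2) * y by rewrite rr; ring.
  by field.
have mpdf : measurable_fun setT (fun x : RM => normal_pdf (0 : R) 1 x).
  exact: measurable_normal_pdf.
have pdf0 (x : R) : 0 <= normal_pdf 0 1 x by exact: normal_pdf_ge0.
pose F (v : RM * RM) := (f v * (normal_pdf 0 1 v.1 * normal_pdf 0 1 v.2)%:E)%E.
have F0 v : (0 <= F v)%E by rewrite mule_ge0// lee_fin mulr_ge0.
have mF : measurable_fun setT F.
  apply: emeasurable_funM => //; apply/measurable_EFinP; apply: measurable_funM.
    exact: measurableT_comp mpdf measurable_fst.
  exact: measurableT_comp mpdf measurable_snd.
have mlin (p q p' q' : R) : measurable_fun setT (fun v : RM * RM =>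
    (p * v.1 + q * v.2 : RM, p' * v.1 + q' * v.2 : RM)).
  by apply: measurable_fun_pair; apply: measurable_funD; apply: measurable_funM.
have mF1 : measurable_fun setT (fun v : RM * RM => F (v.1, r * v.2 + rho * v.1)%R).
  have := measurableT_comp mF (mlin 1 0 rho r).
  by congr measurable_fun; apply/funext => v /=; rewrite mul1r mul0r addr0 addrC.
have mF2 : measurable_fun setT (fun v : RM * RM =>
    F (r^-1 * v.1 - r^-1 * rho * v.2, r * v.2 + rho * (r^-1 * v.1 - r^-1 * rho * v.2))%R).
  have := measurableT_comp mF (mlin r^-1 (- (r^-1 * rho)) (rho * r^-1) (r - rho * (r^-1 * rho))).
  by congr measurable_fun; apply/funext => v /=; congr (F (_, _)); ring.
rewrite (integral_normal_pair mf f0) integral_normal_pair; last 2 first.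
- have := measurableT_comp mf (mlin r^-1 (- (r^-1 * rho)) (rho * r^-1) r^-1).
  by congr measurable_fun; apply/funext => v /=; congr (f (_, _)); ring.
- by move=> v; exact: f0.
transitivity (\int[mu]_x (r%:E * \int[mu]_y F (x, r * y + rho * x)%R))%E.
  apply: eq_integral => x _.
  exact: (ge0_integral_affine (rho * x) r0 (measurableT_comp mF (measurable_pair1 x)) (fun y => F0 _)).
have mI1 : measurable_fun setT (fun x : RM => \int[mu]_y F (x, r * y + rho * x)%R)%E.
  exact: (measurable_fun_fubini_tonelli_F (m2 := mu)
    (fun v => F (v.1, r * v.2 + rho * v.1)%R) mF1 (fun v => F0 _)).
have I10 (x : RM) : (0 <= \int[mu]_y F (x, r * y + rho * x)%R)%E.
  by apply: integral_ge0 => y _.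
apply: etrans (ge0_integralZl_EFin mu measurableT (fun x _ => I10 x) mI1 (ltW r0)) _.
have E1 : (\int[mu]_x \int[mu]_y F (x, r * y + rho * x)%R =
    \int[mu]_y \int[mu]_x F (x, r * y + rho * x)%R)%E.
  exact: (fubini_tonelli (m1 := mu) (m2 := mu)
    (fun v => F (v.1, r * v.2 + rho * v.1)%R) mF1 (fun v => F0 _)).
have I20 (y : RM) : (0 <= \int[mu]_x F (x, r * y + rho * x)%R)%E.
  by apply: integral_ge0 => x _.
have mI2 : measurable_fun setT (fun y : RM => \int[mu]_x F (x, r * y + rho * x)%R)%E.
  exact: (measurable_fun_fubini_tonelli_G (m1 := mu)
    (fun v => F (v.1, r * v.2 + rho * v.1)%R) mF1 (fun v => F0 _)).
apply: etrans (congr1 (fun e => r%:E * e)%E E1) _; clear E1.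
apply: etrans (esym (ge0_integralZl_EFin mu measurableT (fun x _ => I20 x) mI2 (ltW r0))) _.
transitivity (\int[mu]_y \int[mu]_x
    F (r^-1 * x - r^-1 * rho * y, r * y + rho * (r^-1 * x - r^-1 * rho * y))%R)%E.
  apply: eq_integral => y _.
  have E3 := ge0_integral_affine (- (r^-1 * rho * y)) rV0
    (measurableT_comp mF1 (measurable_pair2 y)) (fun x => F0 _).
  apply: etrans (congr1 (fun e => r%:E * e)%E E3) _.
  exact: rrV.
apply: etrans (esym (fubini_tonelli (m1 := mu) (m2 := mu) (fun v =>
    F (r^-1 * v.1 - r^-1 * rho * v.2, r * v.2 + rho * (r^-1 * v.1 - r^-1 * rho * v.2))%R)
    mF2 (fun v => F0 _))) _.
apply: eq_integral => x _; apply: eq_integral => y _; rewrite /F /=.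
rewrite e1 e2; congr (_ * _%:E)%E; apply: normal_pdf_mul.
rewrite !expr_div_n -mulrDl rr; field.
by rewrite gt_eqF.
Qed.

(** If z_a and z_b are the first two coordinates of the image and r = sqrt (1 + rho^2), then [v.1]
    is (z_a + rho z_b) / r and [v.2.1] is (z_b - rho z_a) / r, the normalized noises. *)
Definition rotate3 rho (v : RM * (RM * RM)) : RM * (RM * RM) :=
  ((v.1 - rho * v.2.1) / Num.sqrt (1 + rho ^+ 2),
   ((rho * v.1 + v.2.1) / Num.sqrt (1 + rho ^+ 2), v.2.2)).

Lemma measurable_rotate3 rho : measurable_fun setT (rotate3 rho).
Proof.
have m21 : measurable_fun setT (fun v : RM * (RM * RM) => v.2.1).
  exact: (measurableT_comp measurable_fst measurable_snd).
have m22 : measurable_fun setT (fun v : RM * (RM * RM) => v.2.2).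
  exact: (measurableT_comp measurable_snd measurable_snd).
apply: measurable_fun_pair.
  apply: measurable_funM => //; apply: measurable_funB => //.
  exact: measurable_funM.
apply: measurable_fun_pair => //.
apply: measurable_funM => //; apply: measurable_funD => //.
exact: measurable_funM.
Qed.

Lemma normal_rotation3 rho (f : RM * (RM * RM) -> \bar R) : measurable_fun setT f ->
  (forall x, 0 <= f x)%E ->
  (\int[prod_prob gam (prod_prob gam gam)]_v f v =
   \int[prod_prob gam (prod_prob gam gam)]_v f (rotate3 rho v))%E.
Proof.
move=> mf f0.
pose H (p : RM * RM) := (\int[gam]_w f (p.1, (p.2, w)))%E.
have H0 p : (0 <= H p)%E by apply: integral_ge0 => w _.
have mH : measurable_fun setT H.
  apply: (measurable_integral_snd gam
    (f := fun p : (RM * RM) * RM => f (p.1.1, (p.1.2, p.2)))); last by move=> v; exact: f0.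
  apply: measurableT_comp => //; apply: measurable_fun_pair.
    exact: (measurableT_comp measurable_fst measurable_fst).
  apply: measurable_fun_pair => //.
  exact: (measurableT_comp measurable_snd measurable_fst).
have mHr : measurable_fun setT (fun p : RM * RM =>
    H ((p.1 - rho * p.2) / Num.sqrt (1 + rho ^+ 2), (rho * p.1 + p.2) / Num.sqrt (1 + rho ^+ 2))).
  apply: (measurableT_comp mH); apply: measurable_fun_pair.
    by apply: measurable_funM => //; apply: measurable_funB => //; exact: measurable_funM.
  by apply: measurable_funM => //; apply: measurable_funD => //; exact: measurable_funM.
have mfr := measurableT_comp mf (measurable_rotate3 rho).
apply: etrans (tonelli3 gam gam gam mf f0) _.
apply: etrans (esym (ge0_integral_prod_prob gam gam mH H0)) _.
apply: etrans (normal_rotation rho mH H0) _.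
apply: etrans (ge0_integral_prod_prob gam gam mHr (fun p => H0 _)) _.
exact: esym (tonelli3 gam gam gam mfr (fun v => f0 _)).
Qed.

(** Recovers the noises from a reference sample, whose first entry is (z_a + rho z_b) / r shifted by
    [m]. *)
Definition unrotate a b rho m (v : RM * (RM * RM)) : 3.-tuple RM :=
  place a b (rotate3 rho (v.1 - m, v.2)).

Lemma measurable_unrotate a b rho d (T : measurableType d) (m : T -> RM)
    (v : T -> RM * (RM * RM)) : measurable_fun setT m -> measurable_fun setT v ->
  measurable_fun setT (fun x => unrotate a b rho (m x) (v x)).
Proof.
move=> mm mv; apply: (measurableT_comp (measurable_place a b)).
apply: (measurableT_comp (measurable_rotate3 rho)); apply: measurable_fun_pair.
  apply: measurable_funB => //; exact: (measurableT_comp measurable_fst mv).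
exact: (measurableT_comp measurable_snd mv).
Qed.

(** With m = r s the left side is z_a + s, the observation of user [a]: it depends on [v] only,
    whatever the signal s. *)
Lemma unrotate_shift a b rho m v : a != b ->
  let r := Num.sqrt (1 + rho ^+ 2) in let z := unrotate a b rho m v in
  tnth z a + m / r = (v.1 - rho * v.2.1) / r.
Proof.
move=> ab r z; rewrite tnth_mktuple eqxx /= -/r -mulrDl; congr (_ / _); ring.
Qed.

(** The shift cancels, so the noise given by the genie is a function of [v] alone as well. *)
Lemma unrotate_diff a b rho m v : a != b ->
  let z := unrotate a b rho m v in
  tnth z b - rho * tnth z a = Num.sqrt (1 + rho ^+ 2) * v.2.1.
Proof.
move=> ab z; rewrite !tnth_mktuple !eqxx eq_sym (negbTE ab) /=.
have r20 : 0 < 1 + rho ^+ 2 by rewrite ltr_pwDl// sqr_ge0.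
set r := Num.sqrt _.
have rr : r ^+ 2 = 1 + rho ^+ 2 by rewrite sqr_sqrtr// ltW.
have r0 : r != 0 by rewrite gt_eqF// sqrtr_gt0.
apply: (mulIf r0); rewrite mulrAC -expr2 rr; field.
by rewrite r0.
Qed.

(** Only the first rotated coordinate has another law under the reference, so the cost is the
    divergence of one scalar Gaussian. *)
Lemma noise_donsker_varadhan a b rho m s (psi : 3.-tuple RM -> R) A : a != b -> 1 <= s ->
  measurable_fun setT psi -> (forall x, 0 <= psi x <= A) ->
  (\int[iid gam 3]_z (psi z)%:E <=
   (normal_cost s m + log_mgf (prod_prob (normal_prob 0 s) (prod_prob gam gam))
      (fun v => psi (unrotate a b rho m v)))%:E)%E.
Proof.
move=> ab s1 mpsi psia.
have psi0 x : 0 <= psi x by have /andP[] := psia x.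
have mE : measurable_fun setT (fun x => (psi x)%:E) by exact/measurable_EFinP.
have mp := measurableT_comp mE (measurable_place a b).
have mpr := measurableT_comp mpsi (measurableT_comp (measurable_place a b) (measurable_rotate3 rho)).
rewrite (ge0_integral_noise mE (fun x => _) ab); last by move=> x; rewrite lee_fin.
rewrite (normal_rotation3 rho mp (fun x => _)); last by move=> x; rewrite lee_fin.
exact: (normal_pair_donsker_varadhan (prod_prob gam gam) m s1 mpr (fun v => psia _)).
Qed.

End noise_triple.

(** * Causal strategies *)

Section causal_chain.
Context dK dV (K : measurableType dK) (V : measurableType dV) {R : realType}.
Context (P : probability K R) (Q : probability V R).
Local Notation RM := (measurableTypeR R).
Context (tau : RM -> V -> K) (mtau : measurable_fun setT (fun p : RM * V => tau p.1 p.2)).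
Context (cost : RM -> R) (mcost : measurable_fun setT cost) (cost0 : forall m, 0 <= cost m).
Implicit Types (f : seq K -> RM).

Definition measurable_strategy f :=
  forall t, measurable_fun setT (fun l : t.-tuple K => f l).

Lemma measurable_strategy_cons f z : measurable_strategy f ->
  measurable_strategy (fun s => f (z :: s)).
Proof.
move=> mf t.
exact: (measurableT_comp (mf t.+1) (measurableT_comp (@measurable_cons_pair _ _ _) (measurable_pair1 z))).
Qed.

(* The solution z of [z_t = tau (f (z_0, ..., z_(t-1))) v_t]. *)
Fixpoint untangle n f : n.-tuple V -> n.-tuple K :=
  match n with
  | 0 => fun=> [tuple]
  | n.+1 => fun v => let z := tau (f [::]) (thead v) in
      cons_pair (z, untangle (fun s => f (z :: s)) [tuple of behead v])
  end.

Lemma untangle_cons n f (x : V) (l : n.-tuple V) (z := tau (f [::]) x) :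
  untangle f (cons_pair (x, l)) = cons_pair (z, untangle (fun s => f (z :: s)) l).
Proof.
rewrite /= (_ : thead _ = x); last by rewrite /thead (tnth_nth x).
by congr (cons_pair (_, untangle _ _)); exact: val_inj.
Qed.

Lemma nth_untangle n f (v : n.-tuple V) x0 y0 t : (t < n)%N ->
  nth x0 (untangle f v) t = tau (f (take t (untangle f v))) (nth y0 v t).
Proof.
elim: n f v t => // n IH f v [|t]; case/tupleP: v => x l.
  by rewrite (untangle_cons f x l).
rewrite ltnS => tn.
have := IH (fun s => f (tau (f [::]) x :: s)) l t tn.
by rewrite (untangle_cons f x l).
Qed.

(** The induction absorbs the first sample into the strategy, so the strategy must carry a
    measurable parameter, whose space grows from X to X * V. *)
Lemma measurable_untangle n d (X : measurableType d) (F : X -> seq K -> RM) :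
  (forall t, measurable_fun setT (fun p : X * t.-tuple K => F p.1 p.2)) ->
  measurable_fun setT (fun p : X * n.-tuple V => untangle (F p.1) p.2).
Proof.
elim: n d X F => [|n IH] d X F mF; first exact: measurable_cst.
have mF0 : measurable_fun setT (fun x => F x [::]).
  have := measurableT_comp (mF 0%N) (measurable_pair2 ([tuple] : 0.-tuple K)).
  exact.
have mz : measurable_fun setT (fun p : X * V => tau (F p.1 [::]) p.2).
  exact: (measurableT_comp mtau
    (measurable_fun_pair (measurableT_comp mF0 measurable_fst) measurable_snd)).
pose F' (p : X * V) s := F p.1 (tau (F p.1 [::]) p.2 :: s).
have mF' t : measurable_fun setT (fun p : (X * V) * t.-tuple K => F' p.1 p.2).
  apply: (measurableT_comp (f := fun p : X * t.+1.-tuple K => F p.1 p.2)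
    (g := fun p : (X * V) * t.-tuple K =>
       (p.1.1, cons_pair (tau (F p.1.1 [::]) p.1.2, p.2)))) (mF t.+1) _.
  apply: measurable_fun_pair; first exact: (measurableT_comp measurable_fst measurable_fst).
  apply: (measurableT_comp (@measurable_cons_pair _ _ _)); apply: measurable_fun_pair => //.
  exact: (measurableT_comp mz measurable_fst).
have mg : measurable_fun setT (fun p : X * n.+1.-tuple V => ((p.1, thead p.2), [tuple of behead p.2])).
  apply: measurable_fun_pair.
    apply: measurable_fun_pair => //.
    exact: (measurableT_comp (measurable_tnth ord0) measurable_snd).
  exact: (measurableT_comp (@measurable_behead _ _ _) measurable_snd).
apply: (measurableT_comp (@measurable_cons_pair _ _ _)); apply: measurable_fun_pair.
  exact: (measurableT_comp mz (measurable_fun_pair measurable_fst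
    (measurableT_comp (measurable_tnth ord0) measurable_snd))).
exact: (measurableT_comp (IH _ _ F' mF') mg).
Qed.

Lemma measurable_untangle_strategy n f : measurable_strategy f ->
  measurable_fun setT (fun v : n.-tuple V => untangle f v).
Proof.
move=> mf.
have mF t : measurable_fun setT (fun p : unit * t.-tuple K => (fun _ : unit => f) p.1 p.2).
  exact: (measurableT_comp (mf t) measurable_snd).
exact: (measurableT_comp (measurable_untangle (n := n) mF) (measurable_pair1 tt)).
Qed.

Definition path_cost n f (l : seq K) : R := \sum_(t < n) cost (f (take t l)).

Lemma path_cost_cons n f z l :
  path_cost n.+1 f (z :: l) = cost (f [::]) + path_cost n (fun s => f (z :: s)) l.
Proof. by rewrite /path_cost big_ord_recl take0. Qed.

Lemma path_cost_ge0 n f l : 0 <= path_cost n f l.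
Proof. by apply: sumr_ge0 => t _; exact: cost0. Qed.

Lemma measurable_strategy_take f n t : measurable_strategy f ->
  measurable_fun setT (fun l : n.-tuple K => f (take t l)).
Proof.
(* The prefix [take t l] of an n-tuple has length [minn t n]. *)
move=> mf; apply: (measurableT_comp (mf (minn t n)) (g := fun l : n.-tuple K => take_tuple t l)).
apply/measurable_fun_tnthP => i; pose j := widen_ord (geq_minr t n) i.
have -> : (@tnth _ K)^~ i \o (fun l : n.-tuple K => take_tuple t l) = (@tnth n K)^~ j.
  apply/funext => l /=; rewrite (tnth_nth (tnth l j)) [RHS](tnth_nth (tnth l j)) /= nth_take//.
  by apply: leq_trans (ltn_ord i) (geq_minl _ _).
exact: measurable_tnth.
Qed.

Lemma measurable_path_cost n f : measurable_strategy f ->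
  measurable_fun setT (fun l : n.-tuple K => path_cost n f l).
Proof.
move=> mf; apply: measurable_sum => t.
by apply: (measurableT_comp mcost); exact: measurable_strategy_take.
Qed.

Context (A : R).
Hypothesis step : forall m (psi : K -> R), measurable_fun setT psi ->
  (forall z, 0 <= psi z <= A) ->
  (\int[P]_z (psi z)%:E <= (cost m + log_mgf Q (fun v => psi (tau m v)))%:E)%E.

(* Chain rule: peel off the first time step, and use [log_mgf] of the remaining
   steps as the test function of [step]. *)
Lemma causal_donsker_varadhan n f (phi : n.-tuple K -> R) :
  measurable_strategy f -> measurable_fun setT phi -> (forall z, 0 <= phi z <= A) ->
  (\int[iid P n]_z (phi z)%:E <= \int[iid P n]_z (path_cost n f z)%:E +
     (log_mgf (iid Q n) (fun v => phi (untangle f v)))%:E)%E.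
Proof.
elim: n f phi => [|n IH] f phi mf mphi phiA.
  have mE : measurable_fun setT (fun x => (phi x)%:E) by exact/measurable_EFinP.
  rewrite (ge0_integral_iid0 P mE) (ge0_integral_iid0 P); last first.
    by apply/measurable_EFinP; exact: measurable_path_cost.
  rewrite /path_cost big_ord0 add0e /log_mgf ge0_integral_iid0 /=; last first.
    exact: measurable_cst.
  by rewrite expRK.
have phi0 z : 0 <= phi z by have /andP[] := phiA z.
have mE : measurable_fun setT (fun x => (phi x)%:E) by exact/measurable_EFinP.
have mpc := measurable_path_cost (n := n.+1) mf.
have mpcE : measurable_fun setT (fun l : n.+1.-tuple K => (path_cost n.+1 f l)%:E).
  exact/measurable_EFinP.
have mfz z := measurable_strategy_cons z mf.
have mpcz z : measurable_fun setT (fun l : n.-tuple K => (path_cost n (fun s => f (z :: s)) l)%:E).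
  by apply/measurable_EFinP; exact: measurable_path_cost.
have mphiz z : measurable_fun setT (fun l => phi (cons_pair (z, l))).
  exact: (measurableT_comp mphi (measurableT_comp (@measurable_cons_pair _ _ _) (measurable_pair1 z))).
have mF t : measurable_fun setT (fun p : K * t.-tuple K => f (p.1 :: p.2)).
  exact: (measurableT_comp (mf t.+1) (@measurable_cons_pair _ _ _)).
have mjoint : measurable_fun setT (fun p : K * n.-tuple V =>
    phi (cons_pair (p.1, untangle (fun s => f (p.1 :: s)) p.2))).
  apply: (measurableT_comp mphi); apply: (measurableT_comp (@measurable_cons_pair _ _ _)).
  by apply: measurable_fun_pair => //; exact: (measurable_untangle (F := fun z s => f (z :: s))).
have mjz z : measurable_fun setT (fun v : n.-tuple V =>
    phi (cons_pair (z, untangle (fun s => f (z :: s)) v))).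
  exact: (measurableT_comp mjoint (measurable_pair1 z)).
pose psi z := log_mgf (iid Q n) (fun v => phi (cons_pair (z, untangle (fun s => f (z :: s)) v))).
have mpsi : measurable_fun setT psi by exact: (measurable_log_mgf (iid Q n) mjoint).
have psiA z : 0 <= psi z <= A by exact: (log_mgf_bounds (iid Q n) (mjz z) (fun v => phiA _)).
have psi0 z : 0 <= psi z by have /andP[] := psiA z.
have pc0 m g (l : m.-tuple K) : (0 <= (path_cost m g l)%:E)%E by rewrite lee_fin path_cost_ge0.
have mIpc : measurable_fun setT (fun z => \int[iid P n]_l (path_cost n (fun s => f (z :: s)) l)%:E)%E.
  apply: (measurable_integral_snd (iid P n) (f := fun p : K * n.-tuple K =>
    (path_cost n (fun s => f (p.1 :: s)) p.2)%:E)); last by move=> p; exact: pc0.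
  have mc : measurable_fun setT (fun p : K * n.-tuple K => path_cost n.+1 f (cons_pair p)).
    exact: (measurableT_comp mpc (@measurable_cons_pair _ _ _)).
  apply/measurable_EFinP.
  (* The tail cost is the total cost minus a constant, hence jointly measurable in the first sample
     and the rest. *)
  have -> : (fun p : K * n.-tuple K => path_cost n (fun s => f (p.1 :: s)) p.2) =
      (fun p => path_cost n.+1 f (cons_pair p) - cost (f [::])).
    by apply/funext => p; rewrite path_cost_cons addrC addKr.
  exact: measurable_funB.
have EC : (\int[iid P n.+1]_z (path_cost n.+1 f z)%:E = (cost (f [::]))%:E +
    \int[P]_z \int[iid P n]_l (path_cost n (fun s => f (z :: s)) l)%:E)%E.
  rewrite (ge0_integral_iidS P mpcE (fun z => pc0 _ _ _)).
  rewrite -{1}(integral_probability_cst P (cost (f [::]))) -ge0_integralD//; last 2 first.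
  - by move=> z _; rewrite lee_fin; exact: cost0.
  - by move=> z _; apply: integral_ge0 => l _; exact: pc0.
  apply: eq_integral => z _.
  rewrite -{1}(integral_probability_cst (iid P n) (cost (f [::]))) -ge0_integralD//; last first.
    by move=> l _; rewrite lee_fin; exact: cost0.
  by apply: eq_integral => l _; rewrite path_cost_cons EFinD.
(* Exponentiating the inner [log_mgf] undoes its logarithm, so the two-stage functional is that of
   all n + 1 steps. *)
have EL : log_mgf Q (fun v => psi (tau (f [::]) v)) =
    log_mgf (iid Q n.+1) (fun v => phi (untangle f v)).
  rewrite {1}/log_mgf /(log_mgf (iid Q n.+1) _); congr (ln (fine _)).
  have mexp : measurable_fun setT (fun v : n.+1.-tuple V => (expR (phi (untangle f v)))%:E).
    apply/measurable_EFinP; apply: measurableT_comp => //; apply: (measurableT_comp mphi).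
    exact: measurable_untangle_strategy.
  rewrite (ge0_integral_iidS Q mexp (fun v => _)); last by move=> v; rewrite lee_fin expR_ge0.
  apply: eq_integral => x _.
  rewrite (expR_log_mgf (iid Q n) (mjz _) (fun v => phiA _)).
  by apply: eq_integral => l _; rewrite untangle_cons.
rewrite (ge0_integral_iidS P mE (fun z => _)); last by move=> z; rewrite lee_fin.
(* For each first sample z, the induction hypothesis is applied to the strategy that remembers z. *)
apply: (@le_trans _ _ (\int[P]_z (\int[iid P n]_l (path_cost n (fun s => f (z :: s)) l)%:E + (psi z)%:E))%E).
  apply: ge0_le_integral => //.
  - by move=> z _; apply: integral_ge0 => l _; rewrite lee_fin.
  - apply: (measurable_integral_snd (iid P n) (f := fun p => (phi (cons_pair p))%:E)) => //.
      by apply/measurable_EFinP; exact: (measurableT_comp mphi (@measurable_cons_pair _ _ _)).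
    by move=> p; rewrite lee_fin.
  - by apply: emeasurable_funD => //; exact/measurable_EFinP.
  - by move=> z _; exact: (IH _ _ (mfz z) (mphiz z) (fun l => phiA _)).
rewrite ge0_integralD//; last 3 first.
- by move=> z _; apply: integral_ge0 => l _; exact: pc0.
- by move=> z _; rewrite lee_fin.
- exact/measurable_EFinP.
rewrite EC -EL [X in (_ <= X + _)%E]addeC -[X in (_ <= X)%E]addeA -EFinD.
by apply: leeD2l; exact: step.
Qed.

End causal_chain.

Lemma card_dffun (aT : finType) (rT : aT -> finType) :
  #|{dffun forall x, rT x}| = (\prod_x #|rT x|)%N.
Proof. by rewrite card_dep_ffun foldrE big_map big_enum. Qed.

(** * The channel *)

Section channel.
Context {R : realType} (h : user -> R) (n : nat) (c : channel_code (R := R) n).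
Local Notation RM := (measurableTypeR R).
Local Notation K := (3.-tuple RM).
Local Notation message := (messages c).
Implicit Types (w : message) (z : nat -> user -> R) (i j k : user) (D : seq (user * user)).

(* A pair (j, i) stands for the message from i to j. *)
Definition agree_off D w w' := forall i j, (j, i) \notin D -> w i j = w' i j.

(** The number M of equally likely possibilities for the messages listed in [D]. *)
Definition payload D : nat := (\prod_(p <- D) msgs c p.1 p.2)%N.

Lemma payload_gt0 D : (0 < payload D)%N.
Proof. by apply: prodn_gt0 => p; exact: msgs_gt0. Qed.

Lemma card_messages_uniq D : uniq D ->
  #|message| = (payload D * \prod_(p | p \notin D) msgs c p.1 p.2)%N.
Proof.
move=> uD; rewrite card_dffun.
transitivity (\prod_i \prod_j msgs c j i)%N.
  by apply: eq_bigr => i _; rewrite card_dffun; apply: eq_bigr => j _; rewrite card_ord.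
rewrite exchange_big pair_big /= /payload (bigID (mem D)) /=; congr (_ * _)%N.
by rewrite [RHS]big_uniq.
Qed.

(** A tuple in [S] is determined by its components off [D], so [S] embeds into their product, which
    is smaller than the set of all tuples by the factor [payload c D]. *)
Lemma card_agree_off D (S : {pred message}) : uniq D ->
  {in S &, forall w w', agree_off D w w' -> w = w'} -> (payload D * #|S| <= #|message|)%N.
Proof.
move=> uD injS; rewrite (card_messages_uniq uD) leq_mul2l; apply/orP; right.
(* Components in [D] get a one-element range, which keeps the target a family indexed by all
   pairs. *)
pose size_off (p : user * user) := if p \in D then 1%N else msgs c p.1 p.2.
have size_offP p (m : 'I_(msgs c p.1 p.2)) : ((if p \in D then 0 else m) < size_off p)%N.
  by rewrite /size_off; case: ifP.
pose off w : {dffun forall p : user * user, 'I_(size_off p)} :=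
  [ffun p => Ordinal (size_offP p (w p.2 p.1))].
have inj_off : {in S &, injective off}.
  move=> w w' Sw Sw' eoff; apply: injS => // i j ij.
  have := congr1 (fun g : {dffun forall p : user * user, 'I_(size_off p)} => val (g (j, i))) eoff.
  by rewrite !ffunE /= (negbTE ij) => /val_inj.
rewrite -(card_in_imset inj_off).
apply: leq_trans (max_card _) _; rewrite card_dffun.
rewrite (bigID (mem D)) /= big1 => [|p pD]; last by rewrite card_ord /size_off pD.
by rewrite mul1n; apply: eq_leq; apply: eq_bigr => p pD; rewrite card_ord /size_off (negbTE pD).
Qed.

(** The analogue of [noise] for lists of any length, as strategies are evaluated on prefixes.
    Samples past the end are 0, but the inputs at time t read only those before t. *)
Definition nz (l : seq K) (t : nat) (i : user) : R := tnth (nth [tuple of nseq 3 0] l t) i.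

Definition received w z t i : R :=
  h (i + 1) * input h w z t (i + 2) + h (i + 2) * input h w z t (i + 1) + z t i.

Lemma outputsS w z t i :
  outputs h w z t.+1 i = [tuple of rcons (outputs h w z t i) (received w z t i)].
Proof. by []. Qed.

Lemma eq_outputs w w' z z' t i : (forall u, (u < t)%N -> received w z u i = received w' z' u i) ->
  outputs h w z t i = outputs h w' z' t i.
Proof.
elim: t => // t IH H; rewrite !outputsS; apply: val_inj => /=.
by rewrite IH => [|u ut]; [rewrite H|apply: H; exact: ltnW].
Qed.

Lemma outputs_causal w z z' t i : (forall u j, (u < t)%N -> z u j = z' u j) ->
  outputs h w z t i = outputs h w z' t i.
Proof.
elim: t i => // t IH i H; rewrite !outputsS; apply: val_inj => /=.
have IH' j : outputs h w z t j = outputs h w z' t j.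
  by apply: IH => u k ut; apply: H; exact: ltnW.
by rewrite /received /input !IH' H.
Qed.

Lemma input_causal w z z' t i : (forall u j, (u < t)%N -> z u j = z' u j) ->
  input h w z t i = input h w z' t i.
Proof. by move=> H; rewrite /input (outputs_causal w i H). Qed.

Section measurability.
Context d (T : measurableType d) (z : T -> nat -> user -> RM).
Hypothesis mz : forall t i, measurable_fun setT (fun x => z x t i).

Lemma measurable_outputs w t i : measurable_fun setT (fun x => outputs h w (z x) t i).
Proof.
elim: t i => [|t IH] i; first exact: measurable_cst.
have mx k : measurable_fun setT (fun x => input h w (z x) t k : RM).
  exact: (measurableT_comp (measurable_enc (w k)) (IH k)).
have my : measurable_fun setT (fun x => received w (z x) t i : RM).
  apply: measurable_funD; last exact: mz.
  by apply: measurable_funD; apply: measurable_funM => //; exact: mx.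
apply/measurable_fun_tnthP => k.
have [kt|kt] := ltnP k t.
  have -> : (@tnth _ RM)^~ k \o (fun x => outputs h w (z x) t.+1 i) =
      (@tnth _ RM)^~ (Ordinal kt) \o (fun x => outputs h w (z x) t i).
    by apply/funext => x /=; rewrite !(tnth_nth 0) /= nth_rcons size_tuple kt.
  exact: (measurableT_comp (measurable_tnth _) (IH i)).
have -> // : (@tnth _ RM)^~ k \o (fun x => outputs h w (z x) t.+1 i) = fun x => received w (z x) t i.
apply/funext => x /=; rewrite !(tnth_nth 0) /= nth_rcons size_tuple ltnNge kt /=.
by rewrite (_ : k == t :> nat)// eqn_leq kt -ltnS ltn_ord.
Qed.

Lemma measurable_input w t i : measurable_fun setT (fun x => input h w (z x) t i : RM).
Proof. exact: (measurableT_comp (measurable_enc (w i)) (@measurable_outputs w t i)). Qed.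

End measurability.

Lemma measurable_nz m t i : measurable_fun setT (fun l : m.-tuple K => nz l t i : RM).
Proof.
have [tm|tm] := ltnP t m.
  have -> : (fun l : m.-tuple K => nz l t i : RM) =
      (@tnth _ RM)^~ i \o (@tnth _ K)^~ (Ordinal tm).
    by apply/funext => l; rewrite /nz /= (tnth_nth [tuple of nseq 3 0] l).
  exact: (measurableT_comp (measurable_tnth _) (measurable_tnth _)).
have -> : (fun l : m.-tuple K => nz l t i : RM) = fun=> tnth [tuple of nseq 3 0] i.
  by apply/funext => l; rewrite /nz nth_default// size_tuple.
exact: measurable_cst.
Qed.

Definition correct w z := forall i j, dec (w i) (outputs h w z n i) j = w j i.

Lemma measurable_correct w : measurable [set s : n.-tuple K | correct w (nz s)].
Proof.
have -> : [set s : n.-tuple K | correct w (nz s)] =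
  \bigcap_(i in setT) \bigcap_(j in setT)
    [set s : n.-tuple K | dec (w i) (outputs h w (nz s) n i) j = w j i].
  by apply/seteqP; split=> s H; [move=> i _ j _; exact: H|move=> i j; exact: H].
apply: fin_bigcap_measurable => [|i _]; first exact: finite_finset.
apply: fin_bigcap_measurable => [|j _]; first exact: finite_finset.
have := measurable_outputs (measurable_nz (m := n)) (t := n) w i measurableT (measurable_dec (w i) (w j i)).
by rewrite setTI.
Qed.

Lemma error_set w : [set s : n.-tuple K | exists i j,
    dec (w i) (outputs h w (noise s) n i) j != w j i] = ~` [set s | correct w (nz s)].
Proof.
apply/seteqP; split=> s /=; first by move=> [i [j /eqP ij]] H; exact: ij (H i j).
by move=> /existsNP[i /existsNP[j /eqP ij]]; exists i, j.
Qed.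

Lemma neighbours (i j k : user) : i != j -> i != k -> j != k ->
  (j = i + 1 /\ k = i + 2) \/ (j = i + 2 /\ k = i + 1).
Proof.
by case: i j k => [[|[|[|?]]] ?] [[|[|[|?]]] ?] [[|[|[|?]]] ?] // *;
  by [left; split; exact: val_inj|right; split; exact: val_inj].
Qed.

Lemma receivedE w z t i j k : i != j -> i != k -> j != k ->
  received w z t i = h k * input h w z t j + h j * input h w z t k + z t i.
Proof.
by move=> ij ik jk; have [[-> ->]|[-> ->]] := neighbours ij ik jk; rewrite /received // [X in X + _]addrC.
Qed.

End channel.

(** * Recovering the messages from the observation and the genie's noise *)

Section decoding.
Context {R : realType} (h : user -> R) (n : nat) (c : channel_code (R := R) n).
Context (w w' : messages c) (z z' : nat -> user -> R) (i j k : user).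
Hypotheses (ij : i != j) (ik : i != k) (jk : j != k).
Hypotheses (wz : correct h w z) (wz' : correct h w' z').

Let X := input h w z.
Let X' := input h w' z'.

Lemma eq_sent l : (forall m, w l m = w' l m) -> w l = w' l.
Proof. by move=> H; apply/ffunP. Qed.

Lemma eq_decoded l : w l = w' l -> outputs h w z n l = outputs h w' z' n l ->
  forall m, w m l = w' m l.
Proof. by move=> wl Ol m; rewrite -wz -wz' wl Ol. Qed.

Lemma eq_input l t : w l = w' l -> outputs h w z t l = outputs h w' z' t l -> X t l = X' t l.
Proof. by move=> wl Ol; rewrite /X /X' /input wl Ol. Qed.

(** User i has the same messages and the same outputs in both experiments, hence the same decodings;
    only messages to i could have differed. *)
Lemma decode_mac : agree_off [:: (i, j); (i, k)] w w' ->
  (forall t, (t < n)%N -> z t i + (h k * X t j + h j * X t k) = z' t i + (h k * X' t j + h j * X' t k)) ->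
  w = w'.
Proof.
move=> off sh.
have Hi : w i = w' i.
  by apply: eq_sent => m; apply: off; rewrite !inE !xpair_eqE (negbTE ij) (negbTE ik) !andbF.
have Oi : outputs h w z n i = outputs h w' z' n i.
  apply: eq_outputs => u un; rewrite !(receivedE _ _ _ _ ij ik jk).
  by rewrite addrC sh// addrC.
apply/ffunP => l; have [->//|li] := eqVneq l i; apply: eq_sent => m.
have [->|mi] := eqVneq m i; first exact: eq_decoded.
by apply: off; rewrite !inE !xpair_eqE (negbTE mi).
Qed.

(** After decoding, user i knows all messages of user j. As h_i = rho h_j, the output of j is rho
    (h_j x_k + z_i) plus h_k x_i plus the genie's noise, so i can simulate j and decode in its
    place. *)
Lemma decode_three rho : rho * h j = h i ->
  agree_off [:: (i, j); (i, k); (j, k)] w w' ->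
  (forall t, (t < n)%N -> z t i + (h k * X t j + h j * X t k) = z' t i + (h k * X' t j + h j * X' t k)) ->
  (forall t, (t < n)%N -> z t j - rho * z t i = z' t j - rho * z' t i) ->
  w = w'.
Proof.
move=> rhoE off sh df.
have Hi : w i = w' i.
  by apply: eq_sent => m; apply: off; rewrite !inE !xpair_eqE (negbTE ij) (negbTE ik) !andbF.
have Oi t : (t <= n)%N -> outputs h w z t i = outputs h w' z' t i.
  move=> tn; apply: eq_outputs => u ut; rewrite !(receivedE _ _ _ _ ij ik jk).
  by rewrite addrC sh ?(leq_trans ut)// addrC.
have di := eq_decoded Hi (Oi n (leqnn n)).
have Hj : w j = w' j.
  apply: eq_sent => m; have [->|mi] := eqVneq m i; first exact: di.
  by apply: off; rewrite !inE !xpair_eqE (negbTE mi) (negbTE jk) !andbF.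
have ji : j != i by rewrite eq_sym.
have Oj t : (t <= n)%N -> outputs h w z t j = outputs h w' z' t j.
  (* Isolating h_j x_k + z_i in the observation of i requires the input of j at time t, which is a
     function of the earlier outputs of j; hence the induction on time. *)
  elim: t => // t IH tn; rewrite !outputsS; apply: val_inj => /=.
  have {}IH := IH (ltnW tn); rewrite IH; congr rcons.
  rewrite !(receivedE _ _ _ _ ji jk ik) -/(X _ _) -/(X _ _) -/(X' _ _) -/(X' _ _).
  have := sh t tn; have := df t tn.
  rewrite (eq_input Hj IH) (eq_input Hi (Oi t (ltnW tn))) -rhoE => e1 e2.
  have -> : z t j = (z' t j - rho * z' t i) + rho * z t i by rewrite -e1; ring.
  have -> : z t i = z' t i + (h k * X' t j + h j * X' t k) - (h k * X' t j + h j * X t k).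
    by rewrite -e2; ring.
  ring.
have dj := eq_decoded Hj (Oj n (leqnn n)).
apply/ffunP => l; have [->//|li] := eqVneq l i; have [->//|lj] := eqVneq l j.
apply: eq_sent => m; have [->|mi] := eqVneq m i; first exact: di.
have [->|mj] := eqVneq m j; first exact: dj.
by apply: off; rewrite !inE !xpair_eqE (negbTE mi) (negbTE mj).
Qed.

(** The messages of i and j are known, so their inputs follow from their past outputs; a joint
    induction on time reconstructs the outputs of both users. *)
Lemma decode_broadcast rho : rho * h j = h i ->
  agree_off [:: (i, k); (j, k)] w w' ->
  (forall t, (t < n)%N -> z t i + h j * X t k = z' t i + h j * X' t k) ->
  (forall t, (t < n)%N -> z t j - rho * z t i = z' t j - rho * z' t i) ->
  w = w'.
Proof.
move=> rhoE off sh df.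
have ji : j != i by rewrite eq_sym.
have Hi : w i = w' i.
  by apply: eq_sent => m; apply: off; rewrite !inE !xpair_eqE (negbTE ik) !andbF.
have Hj : w j = w' j.
  by apply: eq_sent => m; apply: off; rewrite !inE !xpair_eqE (negbTE jk) !andbF.
have O t : (t <= n)%N -> outputs h w z t i = outputs h w' z' t i /\
    outputs h w z t j = outputs h w' z' t j.
  elim: t => // t IH tn; rewrite !outputsS.
  have [Oi Oj] := IH (ltnW tn); rewrite Oi Oj.
  have := sh t tn; have := df t tn => e1 e2.
  have Xi := eq_input Hi Oi; have Xj := eq_input Hj Oj.
  split; apply: val_inj => /=; congr rcons.
    rewrite !(receivedE _ _ _ _ ij ik jk) -/(X _ _) -/(X _ _) -/(X' _ _) -/(X' _ _) Xj.
    have -> : z t i = z' t i + h j * X' t k - h j * X t k by rewrite -e2; ring.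
    ring.
  rewrite !(receivedE _ _ _ _ ji jk ik) -/(X _ _) -/(X _ _) -/(X' _ _) -/(X' _ _) Xi -rhoE.
  have -> : z t j = (z' t j - rho * z' t i) + rho * z t i by rewrite -e1; ring.
  have -> : z t i = z' t i + h j * X' t k - h j * X t k by rewrite -e2; ring.
  ring.
have [Oi Oj] := O n (leqnn n).
have di := eq_decoded Hi Oi; have dj := eq_decoded Hj Oj.
apply/ffunP => l; have [->//|li] := eqVneq l i; have [->//|lj] := eqVneq l j.
apply: eq_sent => m; have [->|mi] := eqVneq m i; first exact: di.
have [->|mj] := eqVneq m j; first exact: dj.
by apply: off; rewrite !inE !xpair_eqE (negbTE mi) (negbTE mj).
Qed.

End decoding.

Lemma ge0_integral_affine2 d (T : measurableType d) (R : realType) (Pr : probability T R)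
    (f g : T -> R) (e a b : R) :
  measurable_fun setT f -> measurable_fun setT g -> (forall x, 0 <= f x) ->
  (forall x, 0 <= g x) -> 0 <= e -> 0 <= a -> 0 <= b ->
  (\int[Pr]_x (e + (a * f x + b * g x))%:E =
   e%:E + (a%:E * \int[Pr]_x (f x)%:E + b%:E * \int[Pr]_x (g x)%:E))%E.
Proof.
move=> mf mg f0 g0 e0 a0 b0.
have mfE : measurable_fun setT (fun x => (f x)%:E) by exact/measurable_EFinP.
have mgE : measurable_fun setT (fun x => (g x)%:E) by exact/measurable_EFinP.
have maf : measurable_fun setT (fun x => (a * f x)%:E).
  by apply/measurable_EFinP; exact: measurable_funM.
have mbg : measurable_fun setT (fun x => (b * g x)%:E).
  by apply/measurable_EFinP; exact: measurable_funM.
have scale q (u : T -> R) : 0 <= q -> measurable_fun setT (fun x => (u x)%:E) ->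
    (forall x, 0 <= u x) -> (\int[Pr]_x (q * u x)%:E = q%:E * \int[Pr]_x (u x)%:E)%E.
  by move=> q0 mu u0; rewrite -ge0_integralZl_EFin// => x _; rewrite lee_fin.
transitivity (\int[Pr]_x (e%:E + ((a * f x)%:E + (b * g x)%:E)))%E; first by [].
rewrite ge0_integralD//; last 2 first.
- by move=> x _; rewrite -EFinD lee_fin addr_ge0// mulr_ge0.
- exact: emeasurable_funD.
rewrite integral_probability_cst ge0_integralD//; last 2 first.
- by move=> x _; rewrite lee_fin mulr_ge0.
- by move=> x _; rewrite lee_fin mulr_ge0.
by rewrite !scale.
Qed.

(** * The converse for a single code *)

Section converse.
Context {R : realType} (h : user -> R) (n : nat) (c : channel_code (R := R) n).
Local Notation RM := (measurableTypeR R).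
Local Notation K := (3.-tuple RM).
Local Notation message := (messages c).
Local Notation gam := (normal_prob (0 : R) 1).
Context (P alpha beta rho : R) (i j k : user).
Hypotheses (P0 : 0 <= P) (ij : i != j).
Implicit Types (w : message).

Let r := Num.sqrt (1 + rho ^+ 2).
Let V := (`|alpha| + `|beta|) ^+ 2 * P * (1 + rho ^+ 2).
Let sigma := Num.sqrt (1 + V).

Definition signal w z t := alpha * input h w z t j + beta * input h w z t k.

(** The shift of the normalized noise as a function of the past noise, the length of the list being
    the time. [unrotate] divides the shift by r, which leaves [signal] at user i. *)
Definition strategy w (l : seq K) : RM := r * signal w (nz l) (size l).

Let r20 : 0 < 1 + rho ^+ 2. Proof. by rewrite ltr_pwDl// sqr_ge0. Qed.
Let r0 : 0 < r. Proof. by rewrite sqrtr_gt0. Qed.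
Let V0 : 0 <= V. Proof. by rewrite !mulr_ge0 ?sqr_ge0// ltW. Qed.
Let sigma1 : 1 <= sigma. Proof. by rewrite -[1]sqrtr1 ler_wsqrtr// lerDl. Qed.
Let sigma0 : 0 < sigma. Proof. exact: lt_le_trans sigma1. Qed.
Let sigma2 : sigma ^+ 2 = 1 + V. Proof. by rewrite sqr_sqrtr// addr_ge0. Qed.
Let ln_sigma : ln sigma = ln (1 + V) / 2.
Proof. by rewrite -sigma2 lnXn// -[ln _ *+ 2]mulr_natr mulfK. Qed.

Lemma strategy_take w (l : seq K) t : (t <= size l)%N ->
  strategy w (take t l) = r * signal w (nz l) t.
Proof.
move=> tl; rewrite /strategy size_takel// /signal.
by rewrite !(@input_causal _ _ _ _ w (nz (take t l)) (nz l)) // => u m ut; rewrite /nz nth_take.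
Qed.

Lemma measurable_signal w m t :
  measurable_fun setT (fun l : m.-tuple K => signal w (nz l) t : RM).
Proof.
apply: measurable_funD; apply: measurable_funM => //.
  exact: (measurable_input _ (measurable_nz (m := m))).
exact: (measurable_input _ (measurable_nz (m := m))).
Qed.

Lemma measurable_strategy_signal w : measurable_strategy (strategy w).
Proof.
move=> t.
have -> : (fun l : t.-tuple K => strategy w l) = (fun l => r * signal w (nz l) t).
  by apply/funext => l; rewrite /strategy size_tuple.
by apply: measurable_funM => //; exact: measurable_signal.
Qed.

Local Notation denoise w v := (untangle (unrotate i j rho) (strategy w) v).

Lemma nz_denoise w (v : n.-tuple (RM * (RM * RM))) t l : (t < n)%N ->
  nz (denoise w v) t l =
  tnth (unrotate i j rho (r * signal w (nz (denoise w v)) t) (nth (0, (0, 0)) v t)) l.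
Proof.
move=> tn; rewrite {1}/nz (nth_untangle (unrotate i j rho) (strategy w) v _ (0, (0, 0)) tn).
by rewrite strategy_take// size_tuple ltnW.
Qed.

Lemma denoise_shift w (v : n.-tuple (RM * (RM * RM))) t : (t < n)%N ->
  nz (denoise w v) t i + signal w (nz (denoise w v)) t =
  ((nth (0, (0, 0)) v t).1 - rho * (nth (0, (0, 0)) v t).2.1) / r.
Proof.
move=> tn; rewrite nz_denoise//; set s := signal _ _ _.
rewrite -(unrotate_shift rho (r * s) _ ij) -/r; congr (_ + _).
by rewrite mulrAC divff ?mul1r// gt_eqF.
Qed.

Lemma denoise_diff w (v : n.-tuple (RM * (RM * RM))) t : (t < n)%N ->
  nz (denoise w v) t j - rho * nz (denoise w v) t i = r * (nth (0, (0, 0)) v t).2.1.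
Proof. by move=> tn; rewrite !nz_denoise//; exact: unrotate_diff. Qed.

Context (D : seq (user * user)).
Hypotheses (uD : uniq D)
  (decodable : forall w w' z z', correct h w z -> correct h w' z' -> agree_off D w w' ->
    (forall t, (t < n)%N -> z t i + signal w z t = z' t i + signal w' z' t) ->
    (forall t, (t < n)%N -> z t j - rho * z t i = z' t j - rho * z' t i) -> w = w').

(** For fixed [v], any two message tuples share the observation and the genie's noise, both
    functions of [v]; if both are decoded correctly and agree off [D], then [decodable] identifies
    them. *)
Lemma card_decoded (v : n.-tuple (RM * (RM * RM))) :
  (payload c D * #|[pred w | `[< correct h w (nz (denoise w v)) >]]| <= #|message|)%N.
Proof.
apply: card_agree_off => // w w' /asboolP cw /asboolP cw' off.
apply: (decodable cw cw' off) => t tn.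
  exact: etrans (denoise_shift w v tn) (esym (denoise_shift w' v tn)).
exact: etrans (denoise_diff w v tn) (esym (denoise_diff w' v tn)).
Qed.

Let energy l w := (\sum_(t < n) 'E_(noise_law n)[fun s => (input h w (noise s) t l ^+ 2)%R])%E.

(** From ln x <= x - 1 at x = sigma^-2, as for any divergence. *)
Lemma normal_cost_ge0 (m : RM) : 0 <= normal_cost sigma m.
Proof.
have s2 : 0 < sigma ^+ 2 by rewrite exprn_gt0.
rewrite /normal_cost ln_sigma -mulrDl divr_ge0//.
have : ln (1 + ((sigma ^+ 2)^-1 - 1)) <= (sigma ^+ 2)^-1 - 1.
  by rewrite le_ln1Dx// ltrBrDl subrr invr_gt0.
rewrite addrC subrK lnV// sigma2 -[in X in X -> _]sigma2 => H.
have : (sigma ^+ 2)^-1 <= (1 + m ^+ 2) / sigma ^+ 2.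
  by rewrite ler_pdivlMr// mulVf ?gt_eqF// lerDl sqr_ge0.
move: H; rewrite sigma2; lra.
Qed.

Lemma measurable_normal_cost : measurable_fun setT (normal_cost sigma : RM -> RM).
Proof.
apply: measurable_funD => //; apply: measurable_funM => //; apply: measurable_funB => //.
apply: measurable_funM => //; apply: measurable_funD => //; exact: measurable_funX.
Qed.

Let kappa := r ^+ 2 * (`|alpha| + `|beta|) / (2 * sigma ^+ 2).

Let kappa0 : 0 <= kappa.
Proof. by apply: divr_ge0; apply: mulr_ge0 => //; rewrite ?sqr_ge0// addr_ge0. Qed.

(** Weighted Cauchy-Schwarz: (alpha x + beta y)^2 <= (|alpha| + |beta|) (|alpha| x^2 + |beta| y^2).
    Adaptive encoding may correlate the inputs, so the cross term cannot be dropped; this bound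
    separates the two powers. *)
Lemma normal_cost_signal x y :
  normal_cost sigma (r * (alpha * x + beta * y)) <=
  normal_cost sigma 0 + (kappa * `|alpha| * x ^+ 2 + kappa * `|beta| * y ^+ 2).
Proof.
have s2 : sigma ^+ 2 != 0 by rewrite gt_eqF// exprn_gt0.
have -> : kappa * `|alpha| * x ^+ 2 + kappa * `|beta| * y ^+ 2 =
    r ^+ 2 * ((`|alpha| + `|beta|) * (`|alpha| * x ^+ 2 + `|beta| * y ^+ 2)) / sigma ^+ 2 / 2.
  by rewrite /kappa; field; rewrite gt_eqF.
rewrite /normal_cost expr0n /= addr0 -addrA lerD2l -mulrDl ler_pM2r ?invr_gt0//.
rewrite addrAC -mulrDl lerD2r ler_pM2r ?invr_gt0 ?exprn_gt0// lerD2l exprMn.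
rewrite ler_pM2l ?exprn_gt0//.
have [a0 b0] : 0 <= `|alpha| /\ 0 <= `|beta| by [].
have a2 : alpha ^+ 2 = `|alpha| ^+ 2 by rewrite real_normK ?num_real.
have b2 : beta ^+ 2 = `|beta| ^+ 2 by rewrite real_normK ?num_real.
have h1 : (alpha * beta) * (x * y) * 2 <= `|alpha| * `|beta| * (x ^+ 2 + y ^+ 2).
  apply: le_trans (ler_norm _) _; rewrite !normrM (@ger0_norm _ 2)// -mulrA.
  apply: ler_wpM2l; first by rewrite mulr_ge0.
  have := sqr_ge0 (`|x| - `|y|); rewrite -(real_normK (num_real x)) -(real_normK (num_real y)).
  nra.
have -> : (alpha * x + beta * y) ^+ 2 =
    alpha ^+ 2 * x ^+ 2 + beta ^+ 2 * y ^+ 2 + (alpha * beta) * (x * y) * 2 by ring.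
rewrite a2 b2; nra.
Qed.

Lemma energy_ge0 l w : (0 <= energy l w)%E.
Proof.
apply: sume_ge0 => t _; rewrite unlock; apply: integral_ge0 => s _.
by rewrite lee_fin sqr_ge0.
Qed.

Lemma mean_path_cost w :
  (\int[noise_law n]_s (path_cost (normal_cost sigma) n (strategy w) s)%:E <=
   (n%:R * normal_cost sigma 0)%:E + ((kappa * `|alpha|)%:E * energy j w +
     (kappa * `|beta|)%:E * energy k w))%E.
Proof.
pose x l (t : nat) (s : n.-tuple K) : RM := input h w (nz s) t l.
have mx l t : measurable_fun setT (fun s => x l t s ^+ 2).
  by apply: measurable_funX; exact: (measurable_input _ (measurable_nz (m := n))).
have a0 : 0 <= kappa * `|alpha| by rewrite mulr_ge0.
have b0 : 0 <= kappa * `|beta| by rewrite mulr_ge0.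
pose g t (s : n.-tuple K) := normal_cost sigma 0 +
  (kappa * `|alpha| * x j t s ^+ 2 + kappa * `|beta| * x k t s ^+ 2).
have g0 t s : 0 <= g t s.
  apply: addr_ge0; first exact: normal_cost_ge0.
  by apply: addr_ge0; apply: mulr_ge0 => //; exact: sqr_ge0.
have mg t : measurable_fun setT (fun s => (g t s)%:E).
  apply/measurable_EFinP; apply: measurable_funD => //.
  by apply: measurable_funD; apply: measurable_funM.
apply: (@le_trans _ _ (\int[noise_law n]_s \sum_(t < n) (g t s)%:E)%E).
  apply: ge0_le_integral => //.
  - by move=> s _; rewrite lee_fin; apply: path_cost_ge0; exact: normal_cost_ge0.
  - apply/measurable_EFinP; apply: measurable_path_cost; first exact: measurable_normal_cost.
    exact: measurable_strategy_signal.
  - by apply: emeasurable_sum => t; exact: mg.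
  - move=> s _; rewrite sumEFin lee_fin; apply: ler_sum => t _.
    rewrite strategy_take ?size_tuple ?(ltnW (ltn_ord t))//.
    exact: normal_cost_signal.
rewrite ge0_integral_sum//; last by move=> t s _; rewrite lee_fin.
have -> : (n%:R * normal_cost sigma 0)%:E = (\sum_(t < n) (normal_cost sigma 0)%:E)%E.
  by rewrite sumEFin sumr_const card_ord mulr_natl.
have x0 l t s : 0 <= x l t s ^+ 2 by exact: sqr_ge0.
rewrite /energy !ge0_sume_distrr; last 2 first.
- by move=> t _; rewrite unlock; apply: integral_ge0 => s _; rewrite lee_fin sqr_ge0.
- by move=> t _; rewrite unlock; apply: integral_ge0 => s _; rewrite lee_fin sqr_ge0.
rewrite -!big_split /= le_eqVlt; apply/orP; left; apply/eqP; apply: eq_bigr => t _.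
rewrite /g (ge0_integral_affine2 _ (mx j t) (mx k t))//; last exact: normal_cost_ge0.
by rewrite unlock.
Qed.

(** The power constraint averages over the messages too, so the energy is bounded only after summing
    over [w]. *)
Lemma total_energy l : (0 < n)%N -> (power h c l <= P%:E)%E ->
  (\sum_w energy l w <= (#|message|%:R * (n%:R * P))%:E)%E.
Proof.
move=> n0 pw.
have N0 : (0 < #|message|)%N.
  rewrite card_dffun prodn_gt0// => m; rewrite card_dffun prodn_gt0// => m'.
  by rewrite card_ord msgs_gt0.
have E0 t w : (0 <= 'E_(noise_law n)[fun s => (input h w (noise s) t l ^+ 2)%R])%E.
  by rewrite unlock; apply: integral_ge0 => s _; rewrite lee_fin sqr_ge0.
have -> : (\sum_w energy l w = (#|message|%:R * n%:R)%:E * power h c l)%E.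
  rewrite /power /msg_mean -ge0_sume_distrr; last by move=> t _; apply: sume_ge0.
  rewrite muleA -EFinM mulfK ?pnatr_eq0 -?lt0n// muleA -EFinM mulfV ?pnatr_eq0 -?lt0n//.
  by rewrite mul1e exchange_big.
by rewrite mulrA [leRHS]EFinM lee_wpmul2l// lee_fin mulr_ge0.
Qed.

Let M : R := (payload c D)%:R.

Let M1 : 1 <= M. Proof. by rewrite ler1n payload_gt0. Qed.

Let Q : probability _ R := prod_prob (normal_prob (0 : R) sigma) (prod_prob gam gam).

Lemma measurable_denoise w : measurable_fun setT (fun v : n.-tuple _ => denoise w v).
Proof.
apply: measurable_untangle_strategy; last exact: measurable_strategy_signal.
exact: measurable_unrotate measurable_fst measurable_snd.
Qed.

Let B w : set (n.-tuple (RM * (RM * RM))) := [set v | correct h w (nz (denoise w v))].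

Let mB w : measurable (B w).
Proof.
have := measurable_denoise w measurableT (measurable_correct h w).
by rewrite setTI.
Qed.

(* Under the reference law, v does not depend on the messages w, so that w cannot
   be guessed from v with probability greater than 1 / M. *)
Lemma sum_correct_reference : (\sum_w M%:E * iid Q n (B w) <= #|message|%:R%:E)%E.
Proof.
have -> : (\sum_w M%:E * iid Q n (B w) =
    \int[iid Q n]_v \sum_w M%:E * (\1_(B w) v)%:E)%E.
  rewrite ge0_integral_sum//; last 2 first.
  - by move=> w; apply: emeasurable_funM => //; exact/measurable_EFinP/measurable_indic.
  - by move=> w v _; rewrite -EFinM lee_fin mulr_ge0// (le_trans ler01).
  apply: eq_bigr => w _; rewrite ge0_integralZl_EFin//; last exact/measurable_EFinP/measurable_indic.
  by rewrite integral_indic// setIT.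
rewrite -[leRHS](integral_probability_cst (iid Q n)).
apply: ge0_le_integral => //.
- move=> v _; apply: sume_ge0 => w _.
  by rewrite -EFinM lee_fin mulr_ge0// (le_trans ler01).
- apply: emeasurable_sum => w; apply: emeasurable_funM => //.
  exact/measurable_EFinP/measurable_indic.
move=> v _; rewrite -ge0_sume_distrr; last by move=> w _; rewrite lee_fin.
rewrite sumEFin -EFinM lee_fin.
have -> : \sum_w (\1_(B w) v : R) = #|[pred w | `[< correct h w (nz (denoise w v)) >]]|%:R.
  rewrite -sum1_card natr_sum [RHS]big_mkcond /=; apply: eq_bigr => w _.
  rewrite indicE inE /=; case: asboolP => [H|H]; first by rewrite mem_set.
  by rewrite memNset.
by rewrite -natrM ler_nat; exact: card_decoded.
Qed.

(** Here expR phi is M on correct decoding and 1 elsewhere, hence at most 1 + M 1_B. Then lm <= expR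
    lm - 1 makes the reference term linear in the probability of [B w], ready to be summed over
    [w]. *)
Lemma decoding_cost w :
  ((ln M)%:E * noise_law n [set s | correct h w (nz s)] <=
   \int[noise_law n]_s (path_cost (normal_cost sigma) n (strategy w) s)%:E +
   M%:E * iid Q n (B w))%E.
Proof.
pose S : set (n.-tuple K) := [set s | correct h w (nz s)].
rewrite -/S.
have mS : measurable S by exact: measurable_correct.
have lnM0 : 0 <= ln M by exact: ln_ge0.
have M0 : 0 < M by exact: lt_le_trans M1.
pose phi (s : n.-tuple K) : R := ln M * \1_S s.
have mphi : measurable_fun setT phi by apply: measurable_funM => //; exact: measurable_indic.
have phiM s : 0 <= phi s <= ln M.
  by rewrite /phi indicE; case: (_ \in _); rewrite ?mulr1 ?mulr0 lexx lnM0.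
have mtau : measurable_fun setT (fun p : RM * (RM * (RM * RM)) => unrotate i j rho p.1 p.2).
  exact: measurable_unrotate measurable_fst measurable_snd.
have dv := causal_donsker_varadhan (P := iid gam 3) (Q := Q) mtau measurable_normal_cost
  normal_cost_ge0 (fun m psi mpsi psiM => noise_donsker_varadhan rho m ij sigma1 mpsi psiM)
  (measurable_strategy_signal w) mphi phiM.
have -> : ((ln M)%:E * noise_law n S = \int[noise_law n]_s (phi s)%:E)%E.
  rewrite /phi; under eq_integral do rewrite EFinM.
  rewrite ge0_integralZl_EFin//; last exact/measurable_EFinP/measurable_indic.
  by rewrite integral_indic// setIT.
apply: (le_trans dv); apply: leeD2l.
set lm := log_mgf _ _.
have mphid : measurable_fun setT (fun v => phi (denoise w v)).
  exact: (measurableT_comp mphi (measurable_denoise w)).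
have lmE : ((expR lm)%:E = \int[iid Q n]_v (expR (phi (denoise w v)))%:E)%E.
  exact: (expR_log_mgf (iid Q n) mphid (fun v => phiM _)).
have : ((expR lm)%:E <= 1%:E + M%:E * iid Q n (B w))%E.
  have mBE : measurable_fun setT (fun v => (\1_(B w) v)%:E : \bar R).
    exact/measurable_EFinP/measurable_indic.
  have -> : (1%:E + M%:E * iid Q n (B w) = \int[iid Q n]_v (1%:E + M%:E * (\1_(B w) v)%:E))%E.
    rewrite ge0_integralD//; last 2 first.
    - by move=> v _; rewrite -EFinM lee_fin mulr_ge0// ltW.
    - exact: emeasurable_funM.
    rewrite integral_probability_cst ge0_integralZl_EFin//.
    by rewrite integral_indic// setIT.
  rewrite lmE; apply: ge0_le_integral => //.
  - by apply/measurable_EFinP/measurableT_comp.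
  - by apply: emeasurable_funD => //; exact: emeasurable_funM.
  move=> v _; rewrite -EFinM -EFinD lee_fin /phi !indicE.
  have -> : (v \in B w) = (denoise w v \in S) by apply/idP/idP; rewrite !inE.
  by case: (_ \in _); rewrite ?mulr1 ?mulr0 ?addr0 ?expR0// lnK// lerDr.
have := expR_ge1Dx lm => lm1 lm2.
rewrite -(@leeD2lE _ 1%:E)//; apply: le_trans lm2.
by rewrite -EFinD lee_fin.
Qed.

Hypotheses (n_gt0 : (0 < n)%N) (powerP : forall l, (power h c l <= P%:E)%E).

Lemma converse_bound :
  ln M * (1 - fine (error_prob h c)) <= n%:R * (ln (1 + V) / 2) + 1.
Proof.
pose A w : set (n.-tuple K) := [set s | correct h w (nz s)].
pose p w := fine (noise_law n (A w)).
have mA w : measurable (A w) by exact: measurable_correct.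
have pE w : noise_law n (A w) = (p w)%:E by rewrite fineK// fin_num_measure.
set N : R := #|message|%:R.
have N0 : 0 < N.
  rewrite ltr0n card_dffun prodn_gt0// => m; rewrite card_dffun prodn_gt0// => m'.
  by rewrite card_ord msgs_gt0.
have errE : error_prob h c = (N^-1 * \sum_w (1 - p w))%:E.
  rewrite /error_prob /msg_mean EFinM -sumEFin; congr (_ * _)%E; apply: eq_bigr => w _.
  by rewrite error_set EFinB -pE; exact: (probability_setC (noise_law n) (mA w)).
have sumE : \sum_w (1 - p w) = N - \sum_w p w.
  by rewrite sumrB sumr_const.
rewrite errE sumE /=.
have -> : 1 - N^-1 * (N - \sum_w p w) = (\sum_w p w) / N by field; rewrite gt_eqF.
rewrite [leLHS]mulrA ler_pdivrMr//.
have a0 : 0 <= kappa * `|alpha| by rewrite mulr_ge0.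
have b0 : 0 <= kappa * `|beta| by rewrite mulr_ge0.
rewrite -lee_fin mulr_sumr -sumEFin.
have up w : ((ln M * p w)%:E <= (n%:R * normal_cost sigma 0)%:E +
    ((kappa * `|alpha|)%:E * energy j w + (kappa * `|beta|)%:E * energy k w) +
    M%:E * iid Q n (B w))%E.
  rewrite EFinM -pE; apply: le_trans (decoding_cost w) _.
  by apply: leeD2r; exact: mean_path_cost.
apply: le_trans (lee_sum _ (fun w _ => up w)) _.
rewrite !big_split /= -!ge0_sume_distrr; try by move=> w _; first [exact: energy_ge0 | exact: measure_ge0].
apply: (@le_trans _ _ ((N * (n%:R * normal_cost sigma 0))%:E +
  ((kappa * `|alpha|)%:E * (N * (n%:R * P))%:E + (kappa * `|beta|)%:E * (N * (n%:R * P))%:E) +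
  N%:E)%E).
  apply: leeD; last by rewrite ge0_sume_distrr ?sum_correct_reference// => w _; exact: measure_ge0.
  apply: leeD; first by rewrite sumEFin sumr_const -[_ *+ #|_|]mulr_natl.
  by apply: leeD; apply: lee_wpmul2l; rewrite ?lee_fin//; exact: total_energy.
rewrite -!EFinM -!EFinD lee_fin.
have s2 : 1 + V != 0 by rewrite gt_eqF// ltr_pwDl.
(* At full power P the signals cost V / (1 + V) / 2 per channel use; this cancels the negative part
   of [normal_cost sigma 0] and leaves ln (1 + V) / 2. *)
have -> : kappa * `|alpha| * (N * (n%:R * P)) + kappa * `|beta| * (N * (n%:R * P)) =
    N * (n%:R * (V / (1 + V) / 2)).
  have VE : V = (`|alpha| + `|beta|) ^+ 2 * P * r ^+ 2 by rewrite sqr_sqrtr// ltW.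
  by rewrite /kappa sigma2; move: s2; rewrite VE => s2; field.
rewrite /normal_cost ln_sigma expr0n addr0 sigma2.
have -> : (1 / (1 + V) - 1) / 2 = - (V / (1 + V) / 2) by field.
lra.
Qed.

End converse.

(** * Achievable rates *)

Section asymptotics.
Context {R : realType} (P : R) (h : user -> R) (r : user -> user -> R).
Context (c : forall n, channel_code (R := R) n).
Hypotheses (P0 : 0 <= P) (powerP : forall n i, (power h (c n) i <= P%:E)%E).
Hypothesis rateP : forall j i, j != i ->
  log2 (msgs (c n) j i)%:R / n%:R @[n --> \oo] --> r j i.
Hypothesis errorP : error_prob h (c n) @[n --> \oo] --> 0%E.

(** Divide [converse_bound] by n ln 2 and let n grow: the error probability and 1 / (n ln 2)
    vanish. *)
Lemma sum_rates_le (alpha beta rho : R) (i j k : user) (D : seq (user * user)) :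
  i != j -> uniq D -> (forall p, p \in D -> p.1 != p.2) ->
  (forall n (w w' : messages (c n)) z z', correct h w z -> correct h w' z' -> agree_off D w w' ->
    (forall t, (t < n)%N -> z t i + signal h alpha beta j k w z t =
       z' t i + signal h alpha beta j k w' z' t) ->
    (forall t, (t < n)%N -> z t j - rho * z t i = z' t j - rho * z' t i) -> w = w') ->
  \sum_(p <- D) r p.1 p.2 <= C ((`|alpha| + `|beta|) ^+ 2 * P * (1 + rho ^+ 2)).
Proof.
move=> ij uD offD dec; set V := _ * _.
have ln20 : 0 < ln (2 : R) by rewrite ln_gt0// ltr1n.
pose u n : R := \sum_(p <- D) log2 (msgs (c n) p.1 p.2)%:R / n%:R.
have uS : u n @[n --> \oo] --> \sum_(p <- D) r p.1 p.2.
  rewrite /u; elim: D offD {uD dec u} => [|p s IH] offD.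
    by rewrite big_nil; under eq_fun do rewrite big_nil; exact: cvg_cst.
  rewrite big_cons; under eq_fun do rewrite big_cons.
  apply: cvgD; first by apply/rateP/offD; rewrite mem_head.
  by apply: IH => q qs; apply: offD; rewrite inE qs orbT.
have e0 : fine (error_prob h (c n)) @[n --> \oo] --> (0 : R) by exact: fine_cvg errorP.
have scale (x N : R) : N != 0 -> ln x = ln 2 * N * (log2 x / N).
  by move=> N0; rewrite /log2; field; rewrite N0 gt_eqF.
have affine (N : R) : N != 0 ->
    N * (ln (1 + V) / 2) + 1 = ln 2 * N * (C V + (ln 2)^-1 * N^-1).
  by move=> N0; rewrite /C /log2; field; rewrite N0 gt_eqF.
(* The index is shifted since the converse requires a positive block length. *)
have bound n : u n.+1 * (1 - fine (error_prob h (c n.+1))) <= C V + (ln 2)^-1 * n.+1%:R^-1.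
  have := converse_bound P0 ij uD (dec n.+1) (ltn0Sn n) (powerP n.+1).
  rewrite -/V; set e := fine _ => bd.
  have N0 : (n.+1%:R : R) != 0 by rewrite pnatr_eq0.
  have nl : 0 < ln 2 * n.+1%:R :> R by rewrite mulr_gt0.
  have lnM : ln (payload (c n.+1) D)%:R = ln 2 * n.+1%:R * u n.+1.
    rewrite /payload /u.
    elim: (D) => [|p s IH]; first by rewrite !big_nil ln1 mulr0.
    rewrite !big_cons natrM lnM ?posrE ?ltr0n ?msgs_gt0 ?prodn_gt0//; last first.
      by move=> q; exact: msgs_gt0.
    rewrite IH mulrDr; congr (_ + _); exact: scale.
  rewrite lnM in bd.
  rewrite -(ler_pM2l nl) mulrA; apply: le_trans bd _.
  rewrite le_eqVlt; apply/orP; left; apply/eqP; exact: affine.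
have lim1 : u n.+1 * (1 - fine (error_prob h (c n.+1))) @[n --> \oo] --> \sum_(p <- D) r p.1 p.2.
  rewrite -[X in _ --> X]mulr1 -[X in _ * X](subr0 1).
  apply: cvgM; first by have := uS; rewrite -(cvg_shiftS u).
  by apply: cvgB; [exact: cvg_cst|by have := e0; rewrite -(cvg_shiftS (fun n => fine (error_prob h (c n))))].
have lim2 : C V + (ln 2)^-1 * n.+1%:R^-1 @[n --> \oo] --> C V.
  rewrite -[X in _ --> X]addr0 -(mulr0 (ln 2)^-1).
  apply: cvgD; first exact: cvg_cst.
  by apply: cvgM; [exact: cvg_cst|exact: cvg_harmonic].
by apply: (ler_cvg_to lim1 lim2); exact: nearW.
Qed.

(** The SNR Gamma_i. *)
Let gain i : R := h i ^+ 2 * P.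

Lemma mac_bound i j k : i != j -> i != k -> j != k ->
  r i j + r i k <= C ((`|h k| + `|h j|) ^+ 2 * P).
Proof.
move=> ij ik jk.
have := @sum_rates_le (h k) (h j) 0 i j k [:: (i, j); (i, k)] ij.
rewrite expr0n addr0 mulr1 big_cons big_seq1; apply.
- by rewrite /= inE xpair_eqE eqxx (negbTE jk).
- by move=> p; rewrite !inE => /orP[] /eqP ->.
- by move=> n w w' z z' wz wz' off sh _; exact: (decode_mac ij ik jk wz wz' off sh).
Qed.

Lemma three_bound rho i j k : i != j -> i != k -> j != k -> rho * h j = h i ->
  r i j + r i k + r j k <= C ((`|h k| + `|h j|) ^+ 2 * P * (1 + rho ^+ 2)).
Proof.
move=> ij ik jk rhoE.
have := @sum_rates_le (h k) (h j) rho i j k [:: (i, j); (i, k); (j, k)] ij.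
rewrite !big_cons big_nil addr0 addrA; apply.
- by rewrite /= !inE !xpair_eqE eqxx (negbTE jk) (negbTE ij).
- by move=> p; rewrite !inE => /or3P[] /eqP ->.
- by move=> n w w' z z' wz wz' off sh df; exact: (decode_three ij ik jk wz wz' rhoE off sh df).
Qed.

Lemma broadcast_bound i j k : i != j -> i != k -> j != k ->
  r i k + r j k <= C (gain i + gain j).
Proof.
have bc rho a b : a != b -> a != k -> b != k -> rho * h b = h a ->
    r a k + r b k <= C (gain a + gain b).
  move=> ab ak bk rhoE.
  have := @sum_rates_le 0 (h b) rho a b k [:: (a, k); (b, k)] ab.
  rewrite normr0 add0r real_normK ?num_real// big_cons big_seq1.
  (* As in maximum-ratio combining, the SNRs of the two cooperating receivers add up. *)
  have -> : h b ^+ 2 * P * (1 + rho ^+ 2) = gain a + gain b by rewrite /gain -rhoE; ring.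
  apply.
  - by rewrite /= inE xpair_eqE (negbTE ab).
  - by move=> p; rewrite !inE => /orP[] /eqP ->.
  - move=> n w w' z z' wz wz' off sh df.
    apply: (decode_broadcast ab ak bk wz wz' rhoE off _ df) => t tn.
    by have := sh t tn; rewrite /signal !mul0r !add0r.
move=> ij ik jk.
(* Some order of the two receivers admits a [rho]: divide by a nonzero coefficient, or take 0 if
   both vanish. *)
have [hj0|hj0] := eqVneq (h j) 0; last by apply: (bc (h i / h j)) => //; rewrite divfK.
rewrite addrC [X in _ <= C X]addrC; have ji : j != i by rewrite eq_sym.
have [hi0|hi0] := eqVneq (h i) 0; first by apply: (bc 0) => //; rewrite mul0r hj0.
by apply: (bc (h j / h i)) => //; rewrite divfK.
Qed.

(** Each factor of two costs half a bit; the maximum with 1 matches the clipping of [Chat] at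
    zero. *)
Lemma C_le_Chat (m : nat) (x X : R) : 0 <= x -> 1 + x <= 2 ^+ m * Num.max 1 X ->
  C x <= Chat X + m%:R / 2.
Proof.
move=> x0 xX.
have ln20 : 0 < ln (2 : R) by rewrite ln_gt0// ltr1n.
have mx1 : 0 < Num.max 1 X by rewrite lt_max ltr01.
have : ln (1 + x) <= ln 2 * m%:R + ln (Num.max 1 X).
  have -> : ln 2 * m%:R = ln (2 ^+ m : R) by rewrite lnXn// mulr_natr.
  rewrite -lnM ?posrE ?exprn_gt0// ler_ln ?posrE//; last by rewrite mulr_gt0// exprn_gt0.
  by rewrite ltr_pwDl.
have : ln (Num.max 1 X) <= 2 * ln 2 * Chat X.
  rewrite /Chat /C /log2 addrC subrK maxEle; case: ifP => X1.
    apply: (@le_trans _ _ (2 * ln 2 * (ln X / ln 2 / 2))).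
      by rewrite le_eqVlt; apply/orP; left; apply/eqP; field; rewrite gt_eqF.
    by rewrite ler_pM2l ?mulr_gt0// le_max lexx orbT.
  by rewrite ln1 !mulr_ge0 ?(ltW ln20)// le_max lexx.
rewrite [C x]/C /log2 => h1 h2.
rewrite -(@ler_pM2l _ (2 * ln 2)) ?mulr_gt0// mulrDr.
have -> : 2 * ln 2 * (ln (1 + x) / ln 2 / 2) = ln (1 + x) by field; rewrite gt_eqF.
have -> : 2 * ln 2 * (m%:R / 2) = ln 2 * m%:R :> R by field.
lra.
Qed.

Lemma sqr_sum_le (m : R) j k : gain j <= m -> gain k <= m ->
  (`|h k| + `|h j|) ^+ 2 * P <= 4 * m.
Proof.
rewrite /gain -(real_normK (num_real (h j))) -(real_normK (num_real (h k))) => jm km.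
have : 0 <= (`|h k| - `|h j|) ^+ 2 * P by rewrite mulr_ge0 ?sqr_ge0.
nra.
Qed.

(* If h_j = 0, no multiple of the noise at user i stands for the noise at user j
   in [three_bound]; the multiple-access and broadcast bounds then suffice. *)
Lemma three_sum (m X : R) i j k : 0 <= r i k -> i != j -> i != k -> j != k ->
  gain j <= m -> gain k <= m -> m <= X -> gain i <= X -> m * gain i <= X * gain j ->
  (gain j = 0 -> gain i = 0 \/ gain k = 0) ->
  r i j + r i k + r j k <= Chat X + 2.
Proof.
move=> rik ij ik jk jm km mX iX mi j0.
have gain0 l : 0 <= gain l by rewrite mulr_ge0// sqr_ge0.
have X0 : 0 <= X by apply: le_trans iX.
have S0 : 0 <= (`|h k| + `|h j|) ^+ 2 * P by rewrite mulr_ge0// sqr_ge0.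
have S4 := sqr_sum_le jm km.
(* 1 + 8 X <= 9 max(1, X) <= 2^4 max(1, X), whence 4 / 2 = 2 bits. *)
have finish x : 0 <= x -> x <= 8 * X -> C x <= Chat X + 2.
  move=> x0 x8; have -> : 2 = 4%:R / 2 :> R by field.
  apply: C_le_Chat => //.
  have M1 : 1 <= Num.max 1 X by rewrite le_max lexx.
  have MX : X <= Num.max 1 X by rewrite le_max lexx orbT.
  by rewrite -natrX; lra.
(* The received power is at most 4 m, and 4 m (1 + rho^2) <= 8 X since m <= X and m rho^2 <= X. *)
have direct rho : rho * h j = h i -> m * rho ^+ 2 <= X -> r i j + r i k + r j k <= Chat X + 2.
  move=> rhoE rhoX; apply: le_trans (three_bound ij ik jk rhoE) _; apply: finish.
    by rewrite mulr_ge0// addr_ge0// sqr_ge0.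
  by rewrite mulrDr mulr1; have := sqr_ge0 rho; nra.
have [gj0|gj0] := eqVneq (gain j) 0; last first.
  have hj0 : h j != 0 by apply: contraNneq gj0 => hj0; rewrite /gain hj0 expr0n mul0r.
  apply: (direct (h i / h j)); first by rewrite divfK.
  have gjp : 0 < gain j by rewrite lt_def gj0 gain0.
  rewrite -(ler_pM2r gjp); apply: le_trans mi; rewrite le_eqVlt; apply/orP; left; apply/eqP.
  by rewrite /gain; field.
(* If [gain k] vanishes as well, user i receives only noise, so r i j + r i k <= 0; with r i k >= 0
   the broadcast bound controls r j k through [gain i]. *)
have [gk0|gk0] := eqVneq (gain k) 0.
  have S00 : (`|h k| + `|h j|) ^+ 2 * P = 0.
    by apply/le_anti; rewrite S0 andbT -[leRHS](mulr0 4); apply: sqr_sum_le; rewrite ?gj0 ?gk0.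
  have := mac_bound ij ik jk; rewrite S00.
  have -> : C 0 = 0 :> R by rewrite /C /log2 addr0 ln1 !mul0r.
  have := broadcast_bound ij ik jk; rewrite gj0 addr0.
  have := @finish (gain i) (gain0 _).
  have : gain i <= 8 * X by lra.
  by move=> g8 /(_ g8); lra.
(* What remains is h_i = h_j = 0, where rho = 0 is a valid multiple. *)
have [gi0|/eqP] := j0 gj0; last by rewrite (negbTE gk0).
have P_neq0 : P != 0 by apply: contraNneq gk0 => p0; rewrite /gain p0 mulr0.
have h0 l : gain l = 0 -> h l = 0.
  by move=> /eqP; rewrite /gain mulf_eq0 (negbTE P_neq0) orbF sqrf_eq0 => /eqP.
by apply: (direct 0); rewrite ?expr0n ?mulr0// mul0r h0.
Qed.

End asymptotics.

Theorem lemma1 (R : realType) (G : user -> R)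
    (G1_ge0 : 0 <= G 1) (G12 : G 1 <= G 2) (G23 : G 2 <= G 3)
    (P : R) (P_ge0 : 0 <= P) (h : user -> R)
    (snr : forall i, G i = h i ^+ 2 * P) :
  capacity_region P h `<=` outer_region G.
Proof.
move=> r [r0 [c [powerP rateP errorP]]]; split=> //.
have G2_ge0 : 0 <= G 2 by apply: le_trans G12.
have G3_ge0 : 0 <= G 3 by apply: le_trans G23.
have three := three_sum P_ge0 powerP rateP errorP.
have n12 : (1 : user) != 2 by [].
have n13 : (1 : user) != 3 by [].
have n23 : (2 : user) != 3 by [].
have n21 : (2 : user) != 1 by [].
have n31 : (3 : user) != 1 by [].
have n32 : (3 : user) != 2 by [].
(* The value X = Gamma_3 Gamma_2 / Gamma_1 dominates both other SNRs, and X Gamma_1 = Gamma_3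
   Gamma_2 is the ratio condition of [three_sum]. *)
have GX : G 1 != 0 -> [/\ G 3 <= G 3 * G 2 / G 1, G 2 <= G 3 * G 2 / G 1
    & G 3 * G 2 / G 1 * G 1 = G 3 * G 2].
  move=> G10; have G1_gt0 : 0 < G 1 by rewrite lt_def G10.
  by split; rewrite ?divfK// ler_pdivlMr//; nra.
(* The sums are brought to the form r i j + r i k + r j k, which fixes the observer i and the
   simulated user j. *)
have -> : r 1 2 + r 1 3 + r 3 2 = r 1 3 + r 1 2 + r 3 2 by ring.
have -> : r 2 1 + r 2 3 + r 3 1 = r 2 3 + r 2 1 + r 3 1 by ring.
have -> : r 3 1 + r 3 2 + r 2 1 = r 3 2 + r 3 1 + r 2 1 by ring.
(* In [three m _ i j k], m bounds the SNRs Gamma_j and Gamma_k of the links into user i: Gamma_3 if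
   i is 1 or 2, and Gamma_2 if i is 3. *)
split; split.
- by apply: (three (G 3) _ 1 3 2); rewrite -?snr ?r0//; try nra.
(* The degenerate case Gamma_2 = 0 forces Gamma_1 = 0, which is [gain i] here and [gain k] in the
   case of observer 3 below. *)
- by apply: (three (G 3) _ 1 2 3); rewrite -?snr ?r0//; try nra; move=> G20; left; lra.
- by apply: (three (G 3) _ 2 3 1); rewrite -?snr ?r0//; try nra.
- move=> G10; have [X3 X2 XE] := GX G10.
  by apply: (three (G 3) _ 2 1 3); rewrite -?snr ?r0// ?XE//; try nra.
- by apply: (three (G 2) _ 3 2 1); rewrite -?snr ?r0//; try nra; move=> G20; right; lra.
- move=> G10; have [X3 X2 XE] := GX G10.
  by apply: (three (G 2) _ 3 1 2); rewrite -?snr ?r0// ?XE ?[G 3 * _]mulrC//; try nra.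
- apply: le_trans (broadcast_bound P_ge0 powerP rateP errorP n12 n13 n23) _.
  rewrite -!snr; suff : C (G 1 + G 2) <= Chat (G 2) + 2%:R / 2 by rewrite divff.
  (* 1 + Gamma_1 + Gamma_2 <= 3 max(1, Gamma_2) <= 2^2 max(1, Gamma_2), hence one bit. *)
  apply: C_le_Chat; first exact: addr_ge0.
  have : G 2 <= Num.max 1 (G 2) by rewrite le_max lexx orbT.
  have : 1 <= Num.max 1 (G 2) by rewrite le_max lexx.
  by rewrite -natrX; lra.
- apply: le_trans (mac_bound P_ge0 powerP rateP errorP n31 n32 n12) _.
  have S4 := @sqr_sum_le _ P h P_ge0 (G 2) 1 2.
  rewrite -!snr in S4.
  (* 1 + 4 Gamma_2 <= 5 max(1, Gamma_2) <= 2^3 max(1, Gamma_2), hence 3/2 bits. *)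
  apply: (C_le_Chat (m := 3)); first by rewrite mulr_ge0// sqr_ge0.
  have : G 2 <= Num.max 1 (G 2) by rewrite le_max lexx orbT.
  have : 1 <= Num.max 1 (G 2) by rewrite le_max lexx.
  by have := S4 G12 (lexx _); rewrite -natrX; lra.
Qed.
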